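(* Let $M$ be a 1-manifold and let $\phi: \mathrm{Homeo}_+(\mathbb{R}) \to \mathrm{Homeo}_+(M)$ be a nontrivial group homomorphism. Then $\phi$ is a topologically diagonal embedding.
   Context: $\mathrm{Homeo}_+(M)$ is the group (under composition) of orientation-preserving homeomorphisms of $M$. Homomorphisms are abstract group homomorphisms (no continuity is assumed). For a group $G \subset \mathrm{Homeo}_+(\mathbb{R})$, a homomorphism $\phi: G \to \mathrm{Homeo}_+(M)$ is a topologically diagonal embedding if there are a collection of pairwise disjoint open intervals $I_n \subset M$ and homeomorphisms $f_n: \mathbb{R} \to I_n$ such that, for all $g \in G$, $\phi(g)(x) = f_n g f_n^{-1}(x)$ if $x \in I_n$, and $\phi(g)(x) = x$ if $x$ lies in none of the $I_n$. *)

(* Defs.v *)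
From HB Require Import structures.
From mathcomp Require Import all_boot all_order all_algebra.
From mathcomp Require Import all_classical all_reals all_analysis.

Set Implicit Arguments.
Unset Strict Implicit.
Unset Printing Implicit Defensive.

Import Order.TTheory GRing.Theory Num.Theory.
Import numFieldNormedType.Exports.

Local Open Scope classical_set_scope.
Local Open Scope ring_scope.

(* f is a homeomorphism from X onto the subset U of Y (with the subspace
   topology); its inverse is the restriction of g to U, and the values of g
   outside U are irrelevant. *)
Definition homeomorphism_onto (X Y : topologicalType) (U : set Y)
    (f : X -> Y) (g : Y -> X) : Prop :=
  [/\ continuous f, {within U, continuous g}, forall x, U (f x),
      cancel f g & forall y, U y -> f (g y) = y].

(* Charts are written as parametrizations R -> M: homeomorphisms from the whole
   line onto an open subset of M. *)
Definition chart (R : realType) (M : topologicalType) (e : R -> M) : Prop :=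
  exists (U : set M) (e' : M -> R), open U /\ homeomorphism_onto U e e'.

(* Manifolds have no boundary; they need not be connected or compact. *)
Definition one_manifold (R : realType) (M : topologicalType) : Prop :=
  [/\ hausdorff_space M, @second_countable M
    & forall x : M, exists e : R -> M, chart e /\ range e x].

(* The partially defined map e'^-1 \o e is strictly increasing near every point
   of its domain. *)
Definition co_oriented (R : realType) (M : Type) (e e' : R -> M) : Prop :=
  forall t t' : R, e t = e' t' ->
    exists2 V : set R, nbhs t V &
      forall s1 s2 s1' s2' : R, V s1 -> V s2 ->
        e s1 = e' s1' -> e s2 = e' s2' -> s1 < s2 -> s1' < s2'.

(* An orientation, given by an oriented atlas. *)
Record orientation (R : realType) (M : topologicalType) := Orientation {
  atlas : set (R -> M);
  atlas_chart : forall e, atlas e -> chart e;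
  atlas_cover : forall x : M, exists2 e, atlas e & range e x;
  atlas_co_oriented : forall e e', atlas e -> atlas e' -> co_oriented e e'
}.

Definition orientation_preserving (R : realType) (M : topologicalType)
    (O : orientation R M) (h : M -> M) : Prop :=
  forall e e', atlas O e -> atlas O e' -> co_oriented (h \o e) e'.

Record Homeo_plus (R : realType) (M : topologicalType) (O : orientation R M) :=
  HomeoPlus {
    homeo_fun :> M -> M;
    homeo_inv : M -> M;
    homeo_funK : cancel homeo_fun homeo_inv;
    homeo_invK : cancel homeo_inv homeo_fun;
    homeo_fun_continuous : continuous homeo_fun;
    homeo_inv_continuous : continuous homeo_inv;
    homeo_orientation : orientation_preserving O homeo_fun
  }.

Section Homeo_plus_group.
Context (R : realType) (M : topologicalType) (O : orientation R M).
Implicit Types f g h : Homeo_plus O.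

Lemma homeo_plus_eq f g : (forall x, f x = g x) -> f = g.
Proof.
case: f g => [f f' fK f'K cf cf' of_] [g g' gK g'K cg cg' og] /= fg0.
have fg : f = g by apply/funext.
subst g.
have fg' : f' = g' by apply/funext => x; rewrite -[in LHS](g'K x) fK.
by subst g'; congr HomeoPlus; exact: Prop_irrelevance.
Qed.

Lemma chart_nbhs (e : R -> M) (t : R) (V : set R) :
  chart e -> nbhs t V -> nbhs (e t) (e @` V).
Proof.
move=> [U [e' [oU [ce ce' Ue eK e'K]]]] tV.
have Ut : U (e t) by exact: Ue.
have ce't : {for e t, continuous e'}.
  by move: ce'; rewrite continuous_open_subspace// => h; exact: (h (e t) (mem_set Ut)).
have h : nbhs (e t) (e' @^-1` V) by apply: ce't; rewrite eK.
have hU := open_nbhs_nbhs (conj oU Ut).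
apply: (@filterS _ (nbhs (e t)) _ _ _ _ (filterI hU h)) => y [Uy Vy]; exists (e' y) => //; exact: e'K.
Qed.

Lemma chart_inj (e : R -> M) : chart e -> injective e.
Proof. by move=> [U [e' [_ [_ _ _ eK _]]]]; exact: can_inj eK. Qed.

Lemma chart_continuous (e : R -> M) : chart e -> continuous e.
Proof. by move=> [U [e' [_ []]]]. Qed.

Lemma orientation_preserving_id : orientation_preserving O idfun.
Proof. by move=> e e' Oe Oe'; exact: atlas_co_oriented Oe Oe'. Qed.

Lemma orientation_preserving_comp f g : orientation_preserving O (f \o g).
Proof.
move=> e e' Oe Oe' t t' /= fget.
have [e0 Oe0 [t0 _ e0t]] := atlas_cover O (g (e t)).
have [V Vt HV] := homeo_orientation Oe Oe0 (esym e0t : (g \o e) t = e0 t0).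
have fe0t : (f \o e0) t0 = e' t' by rewrite /= e0t.
have [W Wt0 HW] := homeo_orientation Oe0 Oe' fe0t.
have cge : {for t, continuous (g \o e)}.
  apply: continuous_comp; first exact: (chart_continuous (atlas_chart Oe)).
  exact: homeo_fun_continuous.
exists (V `&` (g \o e) @^-1` (e0 @` W)).
  apply: filterI => //; apply: cge; rewrite /= -e0t.
  exact: chart_nbhs (atlas_chart Oe0) Wt0.
move=> s1 s2 s1' s2' [Vs1 [r1 Wr1 /= er1]] [Vs2 [r2 Wr2 /= er2]] es1 es2 lt_s.
by apply: (HW r1 r2) => //=; [rewrite er1|rewrite er2|apply: (HV s1 s2)].
Qed.

Lemma orientation_preserving_inv f : orientation_preserving O (homeo_inv f).
Proof.
move=> e e' Oe Oe' t t' /= fet.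
have fe't : (f \o e') t' = e t by rewrite /= -fet homeo_invK.
have [W Wt' HW] := homeo_orientation Oe' Oe fe't.
have cfe : {for t, continuous (homeo_inv f \o e)}.
  apply: continuous_comp; first exact: (chart_continuous (atlas_chart Oe)).
  exact: homeo_inv_continuous.
exists ((homeo_inv f \o e) @^-1` (e' @` W)).
  apply: cfe; rewrite /= fet; exact: chart_nbhs (atlas_chart Oe') Wt'.
have e'I := chart_inj (atlas_chart Oe').
move=> s1 s2 s1' s2' [r1 Wr1 /= er1] [r2 Wr2 /= er2] es1 es2 lt_s.
have {r1 Wr1 er1} Ws1 : W s1' by rewrite -(e'I r1 s1') // er1.
have {r2 Wr2 er2} Ws2 : W s2' by rewrite -(e'I r2 s2') // er2.
have fs1 : f (e' s1') = e s1 by rewrite -es1 homeo_invK.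
have fs2 : f (e' s2') = e s2 by rewrite -es2 homeo_invK.
rewrite ltNge; apply/negP; rewrite le_eqVlt => /orP[/eqP s21|s21].
  have /(chart_inj (atlas_chart Oe)) s12 : e s1 = e s2 by rewrite -fs1 -fs2 s21.
  by rewrite s12 ltxx in lt_s.
have := HW _ _ _ _ Ws2 Ws1 fs2 fs1 s21.
by rewrite ltNge (ltW lt_s).
Qed.

Definition homeo_plus_one : Homeo_plus O :=
  @HomeoPlus R M O idfun idfun (fun=> erefl) (fun=> erefl)
    (fun=> cvg_id) (fun=> cvg_id) orientation_preserving_id.

Definition homeo_plus_mul f g : Homeo_plus O :=
  @HomeoPlus R M O (f \o g) (homeo_inv g \o homeo_inv f)
    (can_comp (@homeo_funK _ _ _ f) (@homeo_funK _ _ _ g))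
    (can_comp (@homeo_invK _ _ _ g) (@homeo_invK _ _ _ f))
    (fun x => continuous_comp (@homeo_fun_continuous _ _ _ g x)
                              (@homeo_fun_continuous _ _ _ f (g x)))
    (fun x => continuous_comp (@homeo_inv_continuous _ _ _ f x)
                              (@homeo_inv_continuous _ _ _ g (homeo_inv f x)))
    (@orientation_preserving_comp f g).

Definition homeo_plus_inv f : Homeo_plus O :=
  @HomeoPlus R M O (homeo_inv f) f
    (@homeo_invK _ _ _ f) (@homeo_funK _ _ _ f)
    (@homeo_inv_continuous _ _ _ f) (@homeo_fun_continuous _ _ _ f)
    (@orientation_preserving_inv f).

Lemma homeo_plus_mulA : associative homeo_plus_mul.
Proof. by move=> f g h; exact: homeo_plus_eq. Qed.

Lemma homeo_plus_mul1 : left_id homeo_plus_one homeo_plus_mul.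
Proof. by move=> f; exact: homeo_plus_eq. Qed.

Lemma homeo_plus_1mul : right_id homeo_plus_one homeo_plus_mul.
Proof. by move=> f; exact: homeo_plus_eq. Qed.

Lemma homeo_plus_mulV : left_inverse homeo_plus_one homeo_plus_inv homeo_plus_mul.
Proof. by move=> f; apply: homeo_plus_eq => x; exact: homeo_funK. Qed.

Lemma homeo_plus_Vmul : right_inverse homeo_plus_one homeo_plus_inv homeo_plus_mul.
Proof. by move=> f; apply: homeo_plus_eq => x; exact: homeo_invK. Qed.

HB.instance Definition _ := gen_eqMixin (Homeo_plus O).
HB.instance Definition _ := gen_choiceMixin (Homeo_plus O).
HB.instance Definition _ := isGroup.Build (Homeo_plus O) homeo_plus_mulA
  homeo_plus_mul1 homeo_plus_1mul homeo_plus_mulV homeo_plus_Vmul.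

End Homeo_plus_group.

Section line_orientation.
Context (R : realType).

Lemma line_chart (e : R -> R) : [set idfun] e -> chart e.
Proof.
move=> ->; exists setT, idfun; split; first exact: openT.
by split=> //; [move=> x; exact: cvg_id|apply: continuous_subspaceT => x; exact: cvg_id].
Qed.

Lemma line_cover (x : R) : exists2 e : R -> R, [set idfun] e & range e x.
Proof. by exists idfun => //; exists x. Qed.

Lemma line_co_oriented (e e' : R -> R) :
  [set idfun] e -> [set idfun] e' -> co_oriented e e'.
Proof.
move=> -> -> t t' _; exists setT; first exact: filterT.
by move=> s1 s2 s1' s2' _ _ /= -> ->.
Qed.

Definition line_orientation : orientation R R :=
  Orientation line_chart line_cover line_co_oriented.

End line_orientation.

(* An open interval of M is an open subset homeomorphic to the line. *)
Definition topologically_diagonal_embedding (R : realType) (M : topologicalType)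
    (O : orientation R M)
    (phi : Homeo_plus (line_orientation R) -> Homeo_plus O) : Prop :=
  exists (J : Type) (I : J -> set M) (f : J -> R -> M) (f' : J -> M -> R),
    [/\ forall n, open (I n),
        trivIset setT I,
        forall n, homeomorphism_onto (I n) (f n) (f' n)
      & forall (g : Homeo_plus (line_orientation R)) (x : M),
          (forall n, I n x -> phi g x = f n (g (f' n x))) /\
          ((forall n, ~ I n x) -> phi g x = x)].

(* Main.v *)
Require Import Defs.
From mathcomp Require Import all_boot all_order all_algebra.
From mathcomp Require Import all_classical all_reals all_analysis.
From mathcomp Require Import ring lra.

Set Implicit Arguments.
Unset Strict Implicit.
Unset Printing Implicit Defensive.

Import Order.TTheory GRing.Theory Num.Theory.
Import numFieldNormedType.Exports.

Local Open Scope classical_set_scope.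
Local Open Scope ring_scope.

(** Let G be the group of increasing homeomorphisms of the line, acting on the
one-manifold M through a homomorphism psi. Two claims give the theorem: the
stabilizer of a point x that G moves is the stabilizer in G of a single point t
of the line (point_stabilizer), and then the equivariant injection of the line
into M that sends t to x is a homeomorphism onto an open set
(orbit_map_homeomorphism). The orbits of the moved points are then disjoint open
intervals on which G acts by conjugates of its action on the line.

Nothing is assumed about the continuity of psi, so continuity has to be extracted
from the group structure. Since M is second countable, G is covered by countably
many sets A_i such that the quotients u^-1 * v, with u and v in the same A_i, move
a given compact arc only a little. The form of automatic continuity that is used
(ray_words) says that every element supported in a ray ]a, +oo[, with a depending
only on the cover, is a product of 20 such quotients. It is a diagonal argument in
the style of Rosendal and Solecki: if each of infinitely many disjoint families of
intervals carried a bad element, gluing the bad elements would give an element of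
G that lies in no A_i; commutators then remove the uncontrolled part outside one
family (diagonal_extension). This gives the bounded elements (bounded_words). An
element that is unbounded towards +oo is first cut into two elements with arbitrarily
far intervals of fixed points, and their tails are contracted into the controlled
family by an element of the form c_al^-1 * c_be, where c_al runs through an
uncountable family indexed by real numbers, so that two of them lie in a common
A_i (dilations_quotient, tail_words).

Consequences for actions: near each end of each subinterval of the line, G acts
on M by small moves (ray_orbit_small), a subgroup of countable index is the whole
group (countable_index_full), and a point fixed by all elements supported in rays
]-oo, b[ is fixed by G (fixed_by_left).

The dynamical input is that two commuting actions of G on the line by increasing
maps cannot both move a given point, at least when the second one moves it by an
element of bounded support (commuting_actions_trivial). Each group permutes the
countably many hulls of orbits of an element of the other, hence preserves them,
and all these hulls around the point coincide; an element s of the second group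
conjugate to its square by some b then contradicts the order on the hull. As
small supports keep a point inside a chart, this applies to disjoint intervals
near an end, and shows that every point of M is fixed by all elements supported
close enough to any given end of any interval (ray_fixes).

For a moved point x, let r be the infimum of the a such that elements supported in
]a, +oo[ fix x, and l the analogous supremum on the left. If l = r, the stabilizer
of x is that of r, stabilizers of points being maximal subgroups. If l < r, then
disjoint neighborhoods of l and r give two commuting groups in which the
stabilizer of x is a point stabilizer. Their orbits of x are open in M, so they meet
in a second point, whose stabilizer in the first group is too large
(commuting_stabilizers).

Given that the stabilizer of x is the stabilizer of t, the orbit map is continuous at
t. By pigeonhole on an uncountable set of translates, values of the orbit map at
points arbitrarily close to t on either side come arbitrarily close to x, and small
moves near t transport this to all points close to t. Openness is the intermediate
value theorem in a chart. *)

(** * Increasing homeomorphisms of the line *)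

Section line_homeomorphisms.
Context {R : realType}.
Local Notation G := (Homeo_plus (line_orientation R)).
Implicit Types f g h : G.

Lemma homeo_mulE g h x : (g * h)%g x = g (h x). Proof. by []. Qed.

Lemma homeo_oneE x : (1%g : G) x = x. Proof. by []. Qed.

Lemma homeo_KV g x : (g^-1)%g (g x) = x. Proof. exact: homeo_funK. Qed.

Lemma homeo_VK g x : g ((g^-1)%g x) = x. Proof. exact: homeo_invK. Qed.

Lemma homeo_eq g h : (forall x, g x = h x) -> g = h.
Proof. exact: homeo_plus_eq. Qed.

(** Real induction: the supremum of the points up to which the value at s1 is
exceeded cannot be smaller than s2. *)
Lemma locally_increasing (F : R -> R) (a b : R) :
  (forall t, a <= t <= b -> exists2 V, nbhs t V & forall s1 s2, V s1 -> V s2 ->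
     a <= s1 <= b -> a <= s2 <= b -> s1 < s2 -> F s1 < F s2) ->
  forall s1 s2, a <= s1 -> s2 <= b -> s1 < s2 -> F s1 < F s2.
Proof.
move=> locF s1 s2 as1 s2b s12.
pose T := [set t | s1 <= t <= s2 /\ forall u, s1 < u -> u <= t -> F s1 < F u].
have T1 : T s1.
  split; first by rewrite lexx ltW.
  by move=> u s1u us1; move: (lt_le_trans s1u us1); rewrite ltxx.
have ubT : ubound T s2 by move=> t [/andP[]].
have supT : has_sup T by split; [exists s1|exists s2].
set c := sup T.
have s1c : s1 <= c by apply: ub_le_sup => //; exists s2.
have cs2 : c <= s2 by apply: ge_sup => //; exists s1.
have [V Vc FV] := locF c ltac:(apply/andP; split; [exact: le_trans as1 s1c|exact: le_trans cs2 s2b]).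
have [e /= e0 eV] := Vc.
have inV u : c - e < u -> u < c + e -> V u.
  by move=> h1 h2; apply: eV => /=; rewrite ltr_distlC; apply/andP.
have [t Tt ct] := sup_adherent e0 supT; rewrite -/c in ct.
have tc : t <= c by apply: ub_le_sup => //; exists s2.
have [/andP[s1t ts2] Ft] := Tt.
have key u : s1 < u -> u < c + e -> u <= s2 -> F s1 < F u.
  move=> s1u uc us2; have [ut|tu] := leP u t; first exact: Ft.
  have Vt : V t by apply: inV => //; lra.
  have Vu : V u by apply: inV => //; lra.
  have FtFu : F t < F u by apply: FV => //; apply/andP; split; lra.
  move: s1t; rewrite le_eqVlt => /orP[/eqP->//|s1t].
  by apply: lt_trans FtFu; exact: Ft.
have cs2' : c = s2.
  apply/eqP; rewrite eq_le cs2 /= leNgt; apply/negP => lt_c.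
  have [d [cd de ds2]] : exists d, [/\ c < d, d < c + e & d <= s2].
    exists (Num.min s2 (c + e / 2)); rewrite lt_min gt_min ge_min lexx lt_c /=.
    by split => //; [lra|apply/orP; right; lra].
  have Td : T d.
    split; first by apply/andP; split; lra.
    by move=> u s1u ud; apply: key => //; lra.
  by have := ub_le_sup (ex_intro _ s2 ubT) Td; rewrite -/c leNgt cd.
by apply: key => //; lra.
Qed.

Lemma homeo_lt g : {homo g : x y / x < y}.
Proof.
move=> x y xy; apply: (@locally_increasing g x y) => // t _.
have [V Vt HV] := homeo_orientation (h := g) (erefl : atlas (line_orientation R) idfun)
  (erefl : atlas (line_orientation R) idfun) (erefl : (g \o idfun) t = idfun (g t)).
by exists V => // s1 s2 V1 V2 _ _ s12; exact: (HV s1 s2).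
Qed.

Lemma homeo_le_mono g : {mono g : x y / x <= y}.
Proof. exact: le_mono (@homeo_lt g). Qed.

Lemma homeo_lt_mono g : {mono g : x y / x < y}.
Proof. exact: leW_mono (@homeo_le_mono g). Qed.

Lemma homeo_inj g : injective g.
Proof. exact: can_inj (homeo_KV g). Qed.

Lemma increasing_bij_continuous (f f' : R -> R) : cancel f' f ->
  {homo f : x y / x < y} -> continuous f.
Proof.
move=> f'K finc x; have fm := le_mono finc; have fl := leW_mono fm.
apply/cvgrPdist_lt => e e0.
have h1 : f' (f x - e) < x by rewrite -fl f'K; lra.
have h2 : x < f' (f x + e) by rewrite -fl f'K; lra.
near=> y.
have y1 : f' (f x - e) < y by near: y; exact: lt_nbhsr.
have y2 : y < f' (f x + e) by near: y; exact: lt_nbhsl.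
by rewrite -fl f'K in y1; rewrite -fl f'K in y2; rewrite ltr_distlC; apply/andP; split; lra.
Unshelve. all: by end_near. Qed.

Lemma increasing_inv (f f' : R -> R) : cancel f' f ->
  {homo f : x y / x < y} -> {homo f' : x y / x < y}.
Proof. by move=> f'K finc x y xy; rewrite -(leW_mono (le_mono finc)) !f'K. Qed.

Lemma increasing_orientation (f : R -> R) : {homo f : x y / x < y} ->
  orientation_preserving (line_orientation R) f.
Proof.
move=> finc e e' -> -> t t' _; exists setT; first exact: filterT.
by move=> s1 s2 s1' s2' _ _ /= <- <-; exact: finc.
Qed.

Definition increasing_homeo (f f' : R -> R) (fK : cancel f f') (f'K : cancel f' f)
    (finc : {homo f : x y / x < y}) : G :=
  @HomeoPlus R R (line_orientation R) f f' fK f'K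
    (increasing_bij_continuous f'K finc)
    (increasing_bij_continuous fK (increasing_inv f'K finc))
    (increasing_orientation finc).

(** Support conditions: the support of g lies in ]a, +oo[, respectively in ]-oo, b[. *)
Definition right_of (a : R) g := forall x, x <= a -> g x = x.
Definition left_of (b : R) g := forall x, b <= x -> g x = x.

Lemma right_of_le a b g : a <= b -> right_of b g -> right_of a g.
Proof. by move=> ab gb x xa; apply: gb; exact: le_trans ab. Qed.

Lemma left_of_le a b g : a <= b -> left_of a g -> left_of b g.
Proof. by move=> ab ga x bx; apply: ga; exact: le_trans bx. Qed.

Lemma homeo_fixV g x : g x = x -> (g^-1)%g x = x.
Proof. by move=> gx; rewrite -[in LHS]gx homeo_KV. Qed.


Lemma right_ofM a g h : right_of a g -> right_of a h -> right_of a (g * h)%g.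
Proof. by move=> ga ha x xa; rewrite homeo_mulE ha // ga. Qed.

Lemma right_ofV a g : right_of a g -> right_of a (g^-1)%g.
Proof. by move=> ga x xa; apply: homeo_fixV; exact: ga. Qed.

Lemma homeo_cat f h c : f c = h c ->
  exists k : G, (forall x, x <= c -> k x = f x) /\ (forall x, c <= x -> k x = h x).
Proof.
move=> fhc.
pose F x := if x <= c then f x else h x.
pose F' y := if y <= f c then (f^-1)%g y else (h^-1)%g y.
have FK : cancel F F'.
  move=> x; rewrite /F /F'; case: (leP x c) => xc.
    by rewrite homeo_le_mono xc homeo_KV.
  by rewrite fhc homeo_le_mono leNgt xc; exact: homeo_KV.
have F'K : cancel F' F.
  move=> y; rewrite /F /F'; case: (leP y (f c)) => yc.
    by rewrite -(homeo_le_mono f) homeo_VK yc.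
  by rewrite -(homeo_le_mono h) homeo_VK -fhc leNgt yc.
have Finc : {homo F : x y / x < y}.
  move=> x y xy; rewrite /F; case: (leP x c) => xc; case: (leP y c) => yc.
  - by rewrite homeo_lt_mono.
  - by apply: (@le_lt_trans _ _ (f c)); rewrite ?homeo_le_mono // fhc homeo_lt_mono.
  - by move: (lt_trans (lt_le_trans xy yc) xc); rewrite ltxx.
  - by rewrite homeo_lt_mono.
exists (increasing_homeo FK F'K Finc); split=> x xc /=; rewrite /F; first by rewrite xc.
by move: xc; rewrite le_eqVlt => /orP[/eqP<-|xc]; [rewrite lexx|rewrite leNgt xc].
Qed.

Lemma homeo_affine (s t s' t' : R) : s < t -> s' < t' ->
  exists g : G, g s = s' /\ g t = t'.
Proof.
move=> st st'; pose k := (t' - s') / (t - s).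
have k0 : 0 < k by rewrite divr_gt0 // subr_gt0.
have kn : k != 0 by rewrite gt_eqF.
have FK : cancel (fun x => s' + k * (x - s)) (fun y => s + k^-1 * (y - s')).
  by move=> x; field.
have F'K : cancel (fun y => s + k^-1 * (y - s')) (fun x => s' + k * (x - s)).
  by move=> x; field.
have Finc : {homo (fun x => s' + k * (x - s)) : x y / x < y}.
  by move=> x y xy; rewrite ltrD2l ltr_pM2l // ltrD2r.
exists (increasing_homeo FK F'K Finc); split => /=; first by rewrite subrr mulr0 addr0.
by rewrite /k mulfVK ?subr_eq0 ?gt_eqF // addrC subrK.
Qed.

Fact translationK (a : R) : cancel (fun x => x + a) (fun x => x - a).
Proof. by move=> x; rewrite addrK. Qed.
Fact translationVK (a : R) : cancel (fun x => x - a) (fun x => x + a).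
Proof. by move=> x; rewrite subrK. Qed.
Fact translation_lt (a : R) : {homo (fun x => x + a) : x y / x < y}.
Proof. by move=> x y xy; rewrite ltrD2r. Qed.

Definition translation (a : R) : G :=
  increasing_homeo (translationK a) (translationVK a) (@translation_lt a).

Lemma translationE a x : translation a x = x + a. Proof. by []. Qed.

Lemma translationD a b : translation (a + b) = (translation a * translation b)%g.
Proof. by apply: homeo_eq => x /=; rewrite addrC -addrA addrC (addrC b). Qed.

Lemma translationN a : translation (- a) = ((translation a)^-1)%g.
Proof. by apply: homeo_eq => x. Qed.

Lemma translation0 : translation 0 = 1%g.
Proof. by apply: homeo_eq => x; rewrite translationE addr0. Qed.

Fact dilationK (w k : R) (k0 : 0 < k) :
  cancel (fun x => w + k * (x - w)) (fun x => w + k^-1 * (x - w)).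
Proof. by move=> x; field; rewrite gt_eqF. Qed.
Fact dilationVK (w k : R) (k0 : 0 < k) :
  cancel (fun x => w + k^-1 * (x - w)) (fun x => w + k * (x - w)).
Proof. by move=> x; field; rewrite gt_eqF. Qed.
Fact dilation_lt (w k : R) (k0 : 0 < k) : {homo (fun x => w + k * (x - w)) : x y / x < y}.
Proof. by move=> x y xy; rewrite ltrD2l ltr_pM2l // ltrD2r. Qed.

Definition dilation (w k : R) (k0 : 0 < k) : G :=
  increasing_homeo (dilationK w k0) (dilationVK w k0) (@dilation_lt w k k0).

Lemma dilationE w k k0 x : @dilation w k k0 x = w + k * (x - w). Proof. by []. Qed.

Lemma truncate_right f t c : t < c -> f t < c ->
  exists q : G, (forall x, x <= t -> q x = f x) /\ left_of c q.
Proof.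
move=> tc ftc; have [u [ut uc]] := homeo_affine tc ftc.
have [k [k1 k2]] := homeo_cat (esym ut : f t = u t).
have kc : k c = (1%g : G) c by rewrite k2 ?(ltW tc) // uc.
have [q [q1 q2]] := homeo_cat kc.
exists q; split; last by move=> x cx; rewrite q2.
by move=> x xt; rewrite q1 ?k1 //; exact: le_trans xt (ltW tc).
Qed.

Lemma truncate_left f s b : b < s -> b < f s ->
  exists q : G, (forall x, s <= x -> q x = f x) /\ right_of b q.
Proof.
move=> bs bfs; have [u [ub us]] := homeo_affine bs bfs.
have [k [k1 k2]] := homeo_cat (us : u s = f s).
have kb : (1%g : G) b = k b by rewrite k1 ?(ltW bs) // ub.
have [q [q1 q2]] := homeo_cat kb.
exists q; split; last by move=> x xb; rewrite q1.
by move=> x sx; rewrite q2 ?k2 //; exact: le_trans (ltW bs) sx.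
Qed.

(** Any homeomorphism agrees on a segment with one of bounded support, provided
that the support contains both the segment and its image. *)
Lemma truncate f b s t c : b < s -> b < f s -> s < t -> t < c -> f t < c ->
  exists q : G, [/\ right_of b q, left_of c q & forall x, s <= x <= t -> q x = f x].
Proof.
move=> bs bfs st tc ftc.
have [q1 [q1f q1c]] := truncate_right tc ftc.
have q1s : q1 s = f s by rewrite q1f // ltW.
have [q [qq1 qb]] : exists q : G, (forall x, s <= x -> q x = q1 x) /\ right_of b q.
  by apply: truncate_left; rewrite // q1s.
exists q; split => //.
  by move=> x cx; rewrite qq1 ?q1c //; lra.
by move=> x /andP[sx xt]; rewrite qq1 // q1f.
Qed.

End line_homeomorphisms.

(** * Gluing homeomorphisms along disjoint intervals *)

Section gluing.
Context {R : realType}.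
Local Notation G := (Homeo_plus (line_orientation R)).
Implicit Types g h f : G.

(** An order isomorphism or anti-isomorphism of the line onto a convex set. Allowing
reversed orientation lets one end of the line stand for all ends of all intervals. *)
Definition interval_map (e : R -> R) :=
  ((forall x y, x < y -> e x < e y) \/ (forall x y, x < y -> e y < e x)) /\
  (forall s t y, e s <= y <= e t -> exists u, e u = y).

Lemma interval_map_inj e : interval_map e -> injective e.
Proof.
move=> [mono _] x y exy; apply/eqP; rewrite eq_le !leNgt.
by apply/andP; split; apply/negP => /[dup] xy; case: mono => m /m; rewrite exy ltxx.
Qed.

Lemma interval_map_stays_below e y s s' : interval_map e -> (forall u, e u <> y) ->
  e s < y -> e s' < y.
Proof.
move=> [_ conv] ey sy; rewrite ltNge; apply/negP => ys'.
by have [u] := conv s s' y ltac:(by rewrite (ltW sy)); exact: ey.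
Qed.

Lemma interval_map_stays_above e y s s' : interval_map e -> (forall u, e u <> y) ->
  y < e s -> y < e s'.
Proof.
move=> [_ conv] ey sy; rewrite ltNge; apply/negP => ys'.
by have [u] := conv s' s y ltac:(by rewrite (ltW sy) ys'); exact: ey.
Qed.

Lemma interval_map_comp e e' : interval_map e -> interval_map e' ->
  interval_map (e \o e').
Proof.
move=> [m c] [m' c']; split.
  case: m => m; case: m' => m'; [left|right|right|left] => x y /m'; exact: m.
move=> s t y /= /[dup] ey /c[u uy]; rewrite -uy in ey.
have [v vu] : exists v, e' v = u.
  have mono_le : (forall x y, x <= y -> e x <= e y) \/ (forall x y, x <= y -> e y <= e x).
    by case: m => m; [left|right] => ? ? ; rewrite le_eqVlt => /orP[/eqP->//|/m/ltW].
  have [us|su] := leP u (e' s); have [ut|tu] := leP u (e' t).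
  - case: m => m.
      have [/eqP|lt_us] := eqVneq (e' s) u; first by move=> /eqP <-; exists s.
      have /m : u < e' s by rewrite lt_neqAle eq_sym lt_us.
      by move: ey => /andP[/le_lt_trans h _] /h; rewrite ltxx.
    have [/eqP|lt_ut] := eqVneq (e' t) u; first by move=> /eqP <-; exists t.
    have /m : u < e' t by rewrite lt_neqAle eq_sym lt_ut.
    by move: ey => /andP[_ /le_lt_trans h] /h; rewrite ltxx.
  - by apply: (c' t s); rewrite us ltW.
  - by apply: (c' s t); rewrite ut ltW.
  - case: m => m.
      by move: (m _ _ tu); move: ey => /andP[_ /le_lt_trans h] /h; rewrite ltxx.
    by move: (m _ _ su); move: ey => /andP[/le_lt_trans h _] /h; rewrite ltxx.
by exists v; rewrite vu.
Qed.

Lemma interval_map_homeo g : interval_map g.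
Proof.
split; first by left; exact: homeo_lt.
by move=> s t y _; exists ((g^-1)%g y); rewrite homeo_VK.
Qed.

Lemma interval_map_opp : interval_map (@GRing.opp R).
Proof.
split; first by right => x y; rewrite ltrN2.
by move=> s t y _; exists (- y); rewrite opprK.
Qed.

Definition ray_map (a : R) (t : R) : R := a + expR t.

Lemma ray_map_gt a t : a < ray_map a t.
Proof. by rewrite ltrDl expR_gt0. Qed.

Lemma ray_map_onto a y : a < y -> exists t, ray_map a t = y.
Proof.
move=> ay; exists (ln (y - a)); rewrite /ray_map lnK; first by rewrite addrC subrK.
by rewrite posrE subr_gt0.
Qed.

Lemma interval_map_ray a : interval_map (ray_map a).
Proof.
split; first by left => x y xy; rewrite ltrD2l ltr_expR.
move=> s t y /andP[sy _]; apply: ray_map_onto; apply: lt_le_trans sy; exact: ray_map_gt.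
Qed.

Lemma ray_map_lt a x y : x < y -> ray_map a x < ray_map a y.
Proof. by move=> xy; rewrite ltrD2l ltr_expR. Qed.

Definition segment_map (p q : R) (t : R) : R := q - (q - p) / (1 + expR t).

Lemma segment_map_lt p q x y : p < q -> x < y -> segment_map p q x < segment_map p q y.
Proof.
move=> pq xy; rewrite ltrD2l ltrN2 ltr_pM2l ?subr_gt0 //.
by rewrite ltf_pV2 ?posrE ?addr_gt0 ?expR_gt0 // ltrD2l ltr_expR.
Qed.

Lemma segment_map_in p q t : p < q -> p < segment_map p q t < q.
Proof.
move=> pq; have e0 := expR_gt0 t; have e1 : 0 < 1 + expR t by lra.
have d0 : 0 < (q - p) / (1 + expR t) by rewrite divr_gt0 // subr_gt0.
have d1 : (q - p) / (1 + expR t) < q - p.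
  by rewrite ltr_pdivrMr // mulrDr mulr1 ltrDl mulr_gt0 // subr_gt0.
by rewrite /segment_map; apply/andP; split; lra.
Qed.

Lemma segment_map_onto p q y : p < y < q -> exists t, segment_map p q t = y.
Proof.
move=> /andP[py yq]; exists (ln ((y - p) / (q - y))).
rewrite /segment_map lnK ?posrE ?divr_gt0 ?subr_gt0 //.
have n1 : q - y != 0 by rewrite subr_eq0 gt_eqF.
have n2 : q - p != 0 by rewrite subr_eq0 gt_eqF //; lra.
by field; rewrite n1 /=; apply/eqP => h; move/eqP: n2; apply; rewrite -h; ring.
Qed.

Lemma interval_map_segment p q : p < q -> interval_map (segment_map p q).
Proof.
move=> pq; split; first by left => x y; exact: segment_map_lt.
move=> s t y /andP[sy yt]; apply: segment_map_onto.
have /andP[ps _] := segment_map_in s pq; have /andP[_ tq] := segment_map_in t pq.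
by rewrite (lt_le_trans ps sy) (le_lt_trans yt tq).
Qed.

(** Conjugating by interval maps with disjoint images makes any family of
homeomorphisms, however large, act simultaneously. The verification only involves
the order, because an increasing bijection is automatically continuous. *)
Section family.
Context {J : Type} (E : J -> R -> R).

Definition interval_family :=
  (forall j, interval_map (E j)) /\ (forall j k s t, E j s = E k t -> j = k).

Definition glue_fun (c : J -> G) (x : R) : R :=
  if pselect (exists p : J * R, E p.1 p.2 = x) is left H then
    let p := projT1 (cid H) in E p.1 (c p.1 p.2)
  else x.

Lemma glue_fun_out c x : (forall j t, E j t <> x) -> glue_fun c x = x.
Proof.
by move=> out; rewrite /glue_fun; case: pselect => // -[[j t] /= jt]; case: (out j t).
Qed.

Lemma in_or_out x : (exists j t, x = E j t) \/ (forall j t, E j t <> x).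
Proof.
have [[j [t h]]|H] := pselect (exists j t, E j t = x); first by left; exists j, t.
by right => j t jt; apply: H; exists j, t.
Qed.

Context (hE : interval_family).

Lemma family_inj j k s t : E j s = E k t -> j = k /\ s = t.
Proof.
move=> h; have jk := hE.2 _ _ _ _ h; split => //; rewrite -jk in h.
exact: interval_map_inj (hE.1 j) _ _ h.
Qed.

Lemma glue_fun_in c j t : glue_fun c (E j t) = E j (c j t).
Proof.
rewrite /glue_fun; case: pselect => [H|[]]; last by exists (j, t).
by case: cid => -[k s] /= /family_inj[-> ->].
Qed.

Lemma glue_funM c d x : glue_fun c (glue_fun d x) = glue_fun (fun j => c j * d j)%g x.
Proof.
case: (in_or_out x) => [[j [t ->]]|out]; first by rewrite !glue_fun_in.
by rewrite !(glue_fun_out _ out).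
Qed.

Lemma glue_fun1 x : glue_fun (fun=> 1%g) x = x.
Proof.
case: (in_or_out x) => [[j [t ->]]|out]; first by rewrite !glue_fun_in.
by rewrite !(glue_fun_out _ out).
Qed.

Lemma glue_fun_lt c : {homo glue_fun c : x y / x < y}.
Proof.
move=> x y; case: (in_or_out x) => [[j [s ->]]|outx];
  case: (in_or_out y) => [[k [t ->]]|outy].
- rewrite !glue_fun_in.
  have [jk|njk] := pselect (j = k).
    rewrite -jk => st; case: (hE.1 j).1 => m.
      apply: (m _ _); rewrite homeo_lt_mono ltNge; apply/negP.
      by rewrite le_eqVlt => /orP[/eqP ts|/m]; [rewrite ts ltxx in st|rewrite ltNge (ltW st)].
    apply: (m _ _); rewrite homeo_lt_mono ltNge; apply/negP.
    by rewrite le_eqVlt => /orP[/eqP ts|/m]; [rewrite ts ltxx in st|rewrite ltNge (ltW st)].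
  move=> st; apply: (interval_map_stays_above (s := t) _ (hE.1 k)) => [u /hE.2/esym//|].
  by apply: (interval_map_stays_below (s := s) _ (hE.1 j)) => [u /hE.2//|].
- by rewrite glue_fun_in (glue_fun_out _ outy); exact: interval_map_stays_below _ (hE.1 j) (outy j).
- by rewrite glue_fun_in (glue_fun_out _ outx); exact: interval_map_stays_above _ (hE.1 k) (outx k).
- by rewrite !glue_fun_out.
Qed.

Fact glue_funK c : cancel (glue_fun c) (glue_fun (fun j => (c j)^-1%g)).
Proof.
move=> x; rewrite glue_funM -[RHS]glue_fun1; congr glue_fun.
by apply: funext => j; rewrite mulVg.
Qed.

Fact glue_funVK c : cancel (glue_fun (fun j => (c j)^-1%g)) (glue_fun c).
Proof.
move=> x; rewrite glue_funM -[RHS]glue_fun1; congr glue_fun.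
by apply: funext => j; rewrite mulgV.
Qed.

Definition glue (c : J -> G) : G :=
  increasing_homeo (glue_funK c) (glue_funVK c) (glue_fun_lt c).

Lemma glue_in c j t : glue c (E j t) = E j (c j t).
Proof. exact: glue_fun_in. Qed.

Lemma glue_out c x : (forall j t, E j t <> x) -> glue c x = x.
Proof. exact: glue_fun_out. Qed.

Lemma glueM c d : glue (fun j => c j * d j)%g = (glue c * glue d)%g.
Proof. by apply: homeo_eq => x; rewrite homeo_mulE /= glue_funM. Qed.

Lemma glueV c : glue (fun j => (c j)^-1%g) = ((glue c)^-1)%g.
Proof. by apply: homeo_eq. Qed.

Lemma glue1 : glue (fun=> 1%g) = 1%g.
Proof. by apply: homeo_eq => x; exact: glue_fun1. Qed.

(** The converse of gluing: a homeomorphism that preserves all images is given on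
them by a family of homeomorphisms of the line. *)
Lemma glue_onto (q : G) :
  (forall j t, exists s, q (E j t) = E j s) ->
  (forall j t, exists s, (q^-1)%g (E j t) = E j s) ->
  exists c : J -> G, forall j t, q (E j t) = E j (c j t).
Proof.
move=> q1 q2.
have [F qF] : {F : J -> R -> R & forall j t, q (E j t) = E j (F j t)}.
  by exists (fun j => projT1 (choice (q1 j))) => j t; exact: (projT2 (choice (q1 j))).
have [F' qF'] : {F' : J -> R -> R & forall j t, (q^-1)%g (E j t) = E j (F' j t)}.
  by exists (fun j => projT1 (choice (q2 j))) => j t; exact: (projT2 (choice (q2 j))).
have FK j : cancel (F j) (F' j).
  move=> t; apply: (interval_map_inj (hE.1 j)).
  by rewrite -qF' -qF homeo_KV.
have F'K j : cancel (F' j) (F j).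
  move=> t; apply: (interval_map_inj (hE.1 j)).
  by rewrite -qF -qF' homeo_VK.
have Flt j : {homo F j : x y / x < y}.
  move=> x y xy; have [m|m] := (hE.1 j).1.
    have /(@homeo_lt _ q) := m _ _ xy; rewrite !qF => h.
    rewrite ltNge; apply/negP; rewrite le_eqVlt => /orP[/eqP eF|/m]; last by rewrite ltNge (ltW h).
    by rewrite eF ltxx in h.
  have /(@homeo_lt _ q) := m _ _ xy; rewrite !qF => h.
  rewrite ltNge; apply/negP; rewrite le_eqVlt => /orP[/eqP eF|/m]; last by rewrite ltNge (ltW h).
  by rewrite eF ltxx in h.
by exists (fun j => increasing_homeo (FK j) (F'K j) (Flt j)).
Qed.

End family.

Lemma single_family e : interval_map e -> interval_family (fun _ : unit => e).
Proof. by move=> he; split => // -[] []. Qed.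

(** The injective homomorphism from G onto the group of elements supported in the
image of e. *)
Definition embed e (he : interval_map e) (g : G) : G :=
  glue (single_family he) (fun=> g).

Section embed.
Context e (he : interval_map e).

Lemma embed_in g t : embed he g (e t) = e (g t).
Proof. exact: (glue_in (single_family he) _ tt). Qed.

Lemma embed_out g x : (forall t, e t <> x) -> embed he g x = x.
Proof. by move=> out; apply: (glue_out (single_family he)) => -[]. Qed.

Lemma embedM g h : embed he (g * h)%g = (embed he g * embed he h)%g.
Proof. exact: (glueM (single_family he)). Qed.

Lemma embedV g : embed he (g^-1)%g = ((embed he g)^-1)%g.
Proof. exact: (glueV (single_family he)). Qed.

Lemma embed1 : embed he 1%g = 1%g.
Proof. exact: (glue1 (single_family he)). Qed.

Lemma embed_onto (q : G) : (forall x, (forall t, e t <> x) -> q x = x) ->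
  exists g, q = embed he g.
Proof.
move=> qout.
have inv (q' : G) : (forall x, (forall t, e t <> x) -> q' x = x) ->
    forall j : unit, forall t, exists s, q' (e t) = e s.
  move=> q'out _ t; apply: contrapT => H.
  have out : forall s, e s <> q' (e t) by move=> s es; apply: H; exists s.
  have := q'out _ out => /homeo_inj h; exact: (out t).
have q'out x : (forall t, e t <> x) -> (q^-1)%g x = x.
  by move=> out; apply: homeo_fixV; exact: qout.
have [c hc] := glue_onto (single_family he) (inv q qout) (inv _ q'out).
exists (c tt); apply: homeo_eq => x.
have [[t <-]|out] := pselect (exists t, e t = x); first by rewrite (hc tt) embed_in.
have out' : forall t, e t <> x by move=> t et; apply: out; exists t.
by rewrite embed_out // qout.
Qed.

End embed.

End gluing.

(** * Automatic continuity at the right end of the line *)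

Section steinhaus.
Context {R : realType}.
Local Notation G := (Homeo_plus (line_orientation R)).
Implicit Types g h f : G.

Lemma interval_pigeonhole (Q : nat -> R -> Prop) (p q : R) : p < q ->
  (forall x, p < x < q -> exists i, Q i x) ->
  exists i x y, [/\ p < x, x < y, y < q, Q i x & Q i y].
Proof.
move=> pq HQ; apply: contrapT => no.
have cnt : countable `]p, q[%classic.
  apply/countable_injP.
  have [f Hf] : {f : R -> nat & forall x, p < x < q -> Q (f x) x}.
    have H x : exists i, p < x < q -> Q i x.
      have [/HQ[i Qi]|nx] := pselect (p < x < q); first by exists i.
      by exists 0%N.
    by have [f Hf] := choice H; exists f.
  exists f => x y; rewrite !inE /= !in_itv /= => px py fxy.
  have [//|nxy] := eqVneq x y.
  exfalso; apply: no; exists (f x).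
  have /andP[px1 px2] := px; have /andP[py1 py2] := py.
  have Qx := Hf _ px; have := Hf _ py; rewrite -fxy => Qy.
  by have [xy|yx] := ltrP x y; [exists x, y|exists y, x; split; rewrite // lt_neqAle eq_sym nxy].
have := countable_lebesgue_measure0 cnt.
rewrite lebesgue_measure_itv /= lte_fin pq => /eqP.
by rewrite -EFinD eqe subr_eq0 gt_eqF.
Qed.

(** The infinite swindle: if h performs copies of g on ]a, b[ and on all its
translates by positive multiples of L = b - a, then conjugating h by the
translation removes exactly the first copy. The second factor being a
translation also matters: it puts g in the normal closure of the translations. *)
Lemma bounded_commutator g a b : a < b -> right_of a g -> left_of b g ->
  exists (h : G) (L : R), 0 < L /\
    g = (h * translation L * h^-1 * (translation L)^-1)%g.
Proof.
move=> ab ga gb; pose L := b - a; have L0 : 0 < L by rewrite subr_gt0.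
pose e := segment_map a b; have he : interval_map e := interval_map_segment ab.
have [c gc] : exists c, g = embed he c.
  apply: embed_onto => x out.
  have [/ga//|ax] := leP x a; have [/gb//|xb] := leP b x.
  have [t et] := @segment_map_onto R a b x ltac:(by rewrite ax).
  by case: (out t).
pose E (k : nat) t := translation (L *+ k) (e t).
have Ein k t : a + L *+ k < E k t < b + L *+ k.
  by have /andP[? ?] := segment_map_in t ab; rewrite /E translationE !ltrD2r; apply/andP.
have EL k : a + L *+ k.+1 = b + L *+ k by rewrite mulrS /L; ring.
have hE : interval_family E.
  split => [k|]; first exact: (interval_map_comp (interval_map_homeo _) he).
  suff lt j k s t : (j < k)%N -> E j s < E k t.
    by move=> j k s t Ejk; have [/(lt _ _ s t)|/(lt _ _ t s)|//] := ltngtP j k; rewrite Ejk ltxx.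
  move=> jk; have /andP[_ h1] := Ein j s; have /andP[h2 _] := Ein k t.
  apply: lt_trans h1 _; apply: le_lt_trans h2; rewrite -EL lerD2l.
  by apply: ler_wpMn2l jk; exact: ltW.
pose h := glue hE (fun=> c).
have ES k t : translation L (E k t) = E k.+1 t.
  by rewrite /E !translationE mulrS -addrA (addrC L).
have hin k t : h (E k t) = E k (c t) by exact: (glue_in hE (fun=> c)).
have hout x : (forall k t, E k t <> x) -> h x = x by exact: (glue_out hE (fun=> c)).
have key x : g (translation L (h x)) = h (translation L x).
  case: (in_or_out E x) => [[k [t ->]]|out].
    rewrite hin !ES hin gb //.
    have /andP[h2 _] := Ein k.+1 (c t); apply/ltW/le_lt_trans/h2.
    by rewrite EL lerDl mulrn_wge0 // ltW.
  rewrite hout //; case: (in_or_out E (translation L x)) => [[[|k] [t xE]]|out'].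
  - by rewrite xE hin /E gc mulr0n translation0 !homeo_oneE embed_in.
  - by move: xE; rewrite -ES => /homeo_inj xE; case: (out k t); rewrite xE.
  - by rewrite hout // gc embed_out // => t; have := out' 0%N t; rewrite /E mulr0n translation0.
exists h, L; split=> //; apply: homeo_eq => x.
rewrite -{1}(homeo_VK (translation L) x) -{1}(homeo_VK h ((translation L)^-1 x)%g).
by rewrite key.
Qed.
End steinhaus.

Section words.
Context {T : groupType}.
Implicit Types (V : set T) (u v w : T).

(** For a cover A of the group, the products of boundedly many quotients play the
role of a neighborhood of the identity. *)
Definition quotients (A : nat -> set T) : set T :=
  [set w | exists i u v, A i u /\ A i v /\ w = (u^-1 * v)%g].

Fixpoint words (n : nat) V : set T :=
  if n is n'.+1 then [set w | exists u v, V u /\ words n' V v /\ w = (u * v)%g]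
  else [set 1%g].

Lemma words1 V u : V u -> words 1 V u.
Proof. by move=> Vu; exists u, 1%g; rewrite mulg1. Qed.

Lemma wordsM m n V u v : words m V u -> words n V v -> words (m + n) V (u * v)%g.
Proof.
elim: m u => [|m IH] u /=; first by move=> ->; rewrite mul1g.
move=> [x [y [Vx [Vy ->]]]] Vv; exists x, (y * v)%g; split=> //.
by split; [exact: IH|rewrite mulgA].
Qed.

Lemma quotientsV A u : quotients A u -> quotients A (u^-1)%g.
Proof.
by move=> [i [x [y [Ax [Ay ->]]]]]; exists i, y, x; rewrite invgM invgK.
Qed.

Definition commutator u v : T := (u * v * u^-1 * v^-1)%g.

Lemma words_commutator A u v : quotients A u -> quotients A v ->
  words 4 (quotients A) (commutator u v).
Proof.
move=> Au Av; rewrite /commutator.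
apply: (@wordsM 3 1); last by apply/words1/quotientsV.
apply: (@wordsM 2 1); last by apply/words1/quotientsV.
by apply: (@wordsM 1 1); apply: words1.
Qed.

End words.

Section steinhaus.
Context {R : realType}.
Local Notation G := (Homeo_plus (line_orientation R)).
Implicit Types g h f : G.

(** Every family of commutators on a suitable row (n, m) of intervals is a product of
four quotients. Two diagonal arguments choose n and m: for some n, all data on
the intervals (n, _, _) extend to an element of quotients A, and for some m, all
data on (n, m, _) extend to an element of quotients A that is supported in the
intervals (n, _, _). The commutator of extensions of both kinds is supported in
the intervals (n, m, _), since at every other interval one of the two factors is
trivial. *)
Lemma diagonal_extension (K : Type) (E : nat -> nat -> K -> R -> R)
    (hE : interval_family (fun p : nat * nat * K => E p.1.1 p.1.2 p.2))
    (A : nat -> set G) : (forall g, exists i, A i g) ->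
  exists n m, forall c : K -> G, (forall k, exists a b, c k = commutator a b) ->
    words 4 (quotients A)
      (glue hE (fun p => if (p.1.1 == n) && (p.1.2 == m) then c p.2 else 1%g)).
Proof.
move=> covA.
pose V := quotients A.
have [n Hn] : exists n, forall c : nat -> K -> G, exists d : nat * nat * K -> G,
    (forall m k, d (n, m, k) = c m k) /\ A n (glue hE d).
  apply: contrapT => H.
  have bad n : exists c : nat -> K -> G, forall d : nat * nat * K -> G,
      (forall m k, d (n, m, k) = c m k) -> ~ A n (glue hE d).
    apply: contrapT => H1; apply: H; exists n => c; apply: contrapT => H2.
    by apply: H1; exists c => d dc Ad; apply: H2; exists d.
  have [C HC] := choice bad.
  have [i Ai] := covA (glue hE (fun p => C p.1.1 p.1.2 p.2)).
  exact: (HC i _ _ Ai).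
have {}Hn (c : nat -> K -> G) : exists d : nat * nat * K -> G,
    (forall m k, d (n, m, k) = c m k) /\ V (glue hE d).
  have [d1 [d1E Ad1]] := Hn (fun _ _ => 1%g); have [d2 [d2E Ad2]] := Hn c.
  exists (fun p => (d1 p)^-1 * d2 p)%g; split.
    by move=> m k; rewrite d1E d2E invg1 mul1g.
  by rewrite glueM glueV; exists n, (glue hE d1), (glue hE d2).
pose on_n (c : nat -> K -> G) (p : nat * nat * K) := if p.1.1 == n then c p.1.2 p.2 else 1%g.
have [m Hm] : exists m, forall c : K -> G, exists d : nat -> K -> G,
    d m = c /\ A m (glue hE (on_n d)).
  apply: contrapT => H.
  have bad m : exists c : K -> G, forall d : nat -> K -> G,
      d m = c -> ~ A m (glue hE (on_n d)).
    apply: contrapT => H1; apply: H; exists m => c; apply: contrapT => H2.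
    by apply: H1; exists c => d dc Ad; apply: H2; exists d.
  have [C HC] := choice bad.
  have [i Ai] := covA (glue hE (on_n C)).
  exact: (HC i _ _ Ai).
have {}Hm (c : K -> G) : exists d : nat -> K -> G,
    d m = c /\ V (glue hE (on_n d)).
  have [d1 [d1E Ad1]] := Hm (fun=> 1%g); have [d2 [d2E Ad2]] := Hm c.
  exists (fun j k => (d1 j k)^-1 * d2 j k)%g; split.
    by rewrite d1E d2E; apply: funext => k; rewrite invg1 mul1g.
  suff -> : on_n (fun j k => (d1 j k)^-1 * d2 j k)%g =
      fun p => ((on_n d1 p)^-1 * on_n d2 p)%g.
    by rewrite glueM glueV; exists m, (glue hE (on_n d1)), (glue hE (on_n d2)).
  by apply: funext => p; rewrite /on_n; case: ifP; rewrite // invg1 mul1g.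
exists n, m => c cc.
have [a ha] := choice cc; have [b hb] := choice ha.
have [d [dE Vd]] := Hn (fun j k => if j == m then a k else 1%g).
have [d' [d'E Vd']] := Hm b.
suff -> : (fun p : nat * nat * K => if (p.1.1 == n) && (p.1.2 == m) then c p.2 else 1%g) =
    fun p => commutator (d p) (on_n d' p).
  by rewrite /commutator !glueM !glueV; exact: words_commutator.
apply: funext => -[[i j] k]; rewrite /on_n /=.
case: eqVneq => [->|_] /=; last by rewrite /commutator mulg1 mulgV invg1 mulg1.
rewrite dE; case: eqVneq => [->|_]; first by rewrite hb d'E.
by rewrite /commutator mul1g invg1 mulg1 mulgV.
Qed.

End steinhaus.

Section steinhaus.
Context {R : realType}.
Local Notation G := (Homeo_plus (line_orientation R)).
Implicit Types g h f : G.

(** If the support of g stays away from the ends of ]p, q[, then the support of the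
element c corresponding to g is bounded. *)
Lemma segment_pullback g p a b q (pa : p < a) (ab : a < b) (bq : b < q) (pq : p < q) :
  right_of a g -> left_of b g ->
  exists c a' b', [/\ g = embed (interval_map_segment pq) c, a' < b', right_of a' c
    & left_of b' c].
Proof.
move=> ga gb.
have [c gc] : exists c, g = embed (interval_map_segment pq) c.
  apply: embed_onto => x out.
  have [xp|px] := leP x p; first by apply: ga; lra.
  have [qx|xq] := leP q x; first by apply: gb; lra.
  have [t et] := @segment_map_onto R p q x ltac:(by rewrite px).
  by case: (out t).
have [a' ea] := @segment_map_onto R p q a ltac:(by rewrite pa /=; lra).
have [b' eb] := @segment_map_onto R p q b ltac:(by rewrite bq andbT; lra).
have mono := le_mono (fun x y => @segment_map_lt R p q x y pq).
have ab' : a' < b' by rewrite -(leW_mono mono) ea eb.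
have ca : right_of a' c.
  move=> t; rewrite -mono ea => /ga; rewrite gc embed_in.
  exact: interval_map_inj (interval_map_segment pq) _ _.
have cb : left_of b' c.
  move=> t; rewrite -mono eb => /gb; rewrite gc embed_in.
  exact: interval_map_inj (interval_map_segment pq) _ _.
by exists c, a', b'.
Qed.

Lemma segment_pullback_commutator g p a b q (pa : p < a) (ab : a < b) (bq : b < q)
    (pq : p < q) : right_of a g -> left_of b g ->
  exists c, g = embed (interval_map_segment pq) c /\ exists u v, c = commutator u v.
Proof.
move=> ga gb; have [c [a' [b' [gc ab' ca cb]]]] := segment_pullback pa ab bq pq ga gb.
exists c; split=> //; have [h [L [_ ->]]] := bounded_commutator ab' ca cb.
by exists h, (translation L).
Qed.

Lemma increasing_nat (p : nat -> R) : (forall n, p n < p n.+1) ->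
  forall j k, (j <= k)%N -> p j <= p k.
Proof.
move=> pS j k /subnKC <-; elim: (k - j)%N => [|n IH]; first by rewrite addn0.
by rewrite addnS; apply: le_trans IH (ltW (pS _)).
Qed.

Lemma segments_family (J : Type) (p q : J -> R) (pq : forall j, p j < q j) :
  (forall j k, j <> k -> q j <= p k \/ q k <= p j) ->
  interval_family (fun j => segment_map (p j) (q j)).
Proof.
move=> sep; split => [j|j k s t e]; first exact: interval_map_segment.
apply: contrapT => /sep.
have /andP[h1 h2] := segment_map_in s (pq j).
have /andP[h3 h4] := segment_map_in t (pq k).
by rewrite e in h1 h2 => -[|] h; lra.
Qed.

Lemma sequence_family (p q : nat -> R) : (forall k, p k < q k) ->
  (forall k, q k <= p k.+1) ->
  interval_family (fun k => segment_map (p k) (q k)).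
Proof.
move=> pq qp; have pS k : p k < p k.+1 by apply: lt_le_trans (qp k).
have lt j k : (j < k)%N -> q j <= p k.
  by move=> jk; apply: le_trans (qp j) _; exact: increasing_nat pS _ _ jk.
by apply: segments_family => // j k /eqP; rewrite neq_ltn => /orP[/lt|/lt]; [left|right].
Qed.

(** Otherwise there are disjoint segments, one for each pair (n, m), each carrying
an element that is not a product of four quotients, against diagonal_extension. *)
Lemma bounded_words (A : nat -> set G) : (forall g, exists i, A i g) ->
  exists a, forall b g, right_of a g -> left_of b g -> words 4 (quotients A) g.
Proof.
move=> covA; apply: contrapT => H.
have bad a : exists bg : R * G, [/\ a < bg.1, right_of a bg.2, left_of bg.1 bg.2 &
    ~ words 4 (quotients A) bg.2].
  apply: contrapT => H1; apply: H; exists a => b g ga gb; apply: contrapT => H2.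
  apply: H1; exists (Num.max b a + 1, g); split=> //=.
    by rewrite ltr_pwDr // le_max lexx orbT.
  by apply: left_of_le gb; rewrite ler_wpDr // le_max lexx.
have [F HF] := choice bad.
pose p := fix p (j : nat) := if j is j'.+1 then (F (p j' + 1)).1 + 1 else 0.
have pS j : p j + 1 < p j.+1 - 1.
  by have [h _ _ _] := HF (p j + 1); rewrite [p j.+1]/= addrK.
have pq j : p j < p j.+1 by have := pS j; lra.
have hE : interval_family (fun x : nat * nat * unit =>
    segment_map (p (pickle (x.1.1, x.1.2))) (p (pickle (x.1.1, x.1.2)).+1)).
  apply: segments_family => // -[[n m] []] [[n' m'] []] /= ne.
  have : pickle (n, m) != pickle (n', m').
    by apply/eqP => /(pcan_inj pickleK) [nn mm]; apply: ne; rewrite nn mm.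
  by rewrite neq_ltn => /orP[|] /(increasing_nat pq); [left|right].
have [n [m Hnm]] :=
  @diagonal_extension R unit (fun n m _ =>
    segment_map (p (pickle (n, m))) (p (pickle (n, m)).+1)) hE A covA.
set j := pickle (n, m); have [_ Fr Fl Fbad] := HF (p j + 1).
have Fl' : left_of (p j.+1 - 1) (F (p j + 1)).2.
  by apply: left_of_le Fl; rewrite [p j.+1]/= addrK.
have [c [Fc cc]] := @segment_pullback_commutator (F (p j + 1)).2 (p j) (p j + 1) (p j.+1 - 1) (p j.+1)
  ltac:(by lra) (pS j) ltac:(by lra) (pq j) Fr Fl'.
apply: Fbad; have := Hnm (fun=> c) (fun=> cc).
congr words; apply: homeo_eq => x.
case: (in_or_out (fun x : nat * nat * unit =>
    segment_map (p (pickle (x.1.1, x.1.2))) (p (pickle (x.1.1, x.1.2)).+1)) x) => [[[[n' m'] u] [t xE]]|out].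
  rewrite [in LHS]xE (glue_in hE) /=; case: ifP => [/andP[/eqP en /eqP em]|ne].
    by rewrite xE /= en em -/j Fc embed_in.
  rewrite Fc embed_out // => s es; have := hE.2 (n, m, tt) (n', m', u) s t.
  move=> /= H1; have {H1}[nn mm _] : (n, m, tt) = (n', m', u) by apply: H1; rewrite -xE -es.
  by move: ne; rewrite nn mm !eqxx.
rewrite (glue_out hE) // Fc embed_out // => t.
exact: (out (n, m, tt)).
Qed.

Lemma bernoulli_ge (x : R) n : 0 <= x -> 1 + n%:R * x <= (1 + x) ^+ n.
Proof.
move=> x0; elim: n => [|n IH]; first by rewrite mul0r addr0 expr0.
rewrite exprS; apply: (@le_trans _ _ ((1 + x) * (1 + n%:R * x))).
  have h : 0 <= n%:R * x * x by rewrite !mulr_ge0.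
  by rewrite -[n.+1]addn1 natrD; lra.
by rewrite ler_pM2l //; lra.
Qed.

(** The exponents are chosen before r: e k = k * N k with N k >= l k works because,
by Bernoulli, r ^+ e k >= N k as soon as k * (r - 1) >= 1. *)
Lemma growing_exponents (l : nat -> R) : exists e : nat -> nat,
  forall r, 1 < r -> exists k1, forall k, (k1 <= k)%N -> l k <= r ^+ e k.
Proof.
have arch (x : R) : exists N : nat, x <= N%:R.
  by exists (Num.bound `|x|); apply: le_trans (ler_norm x) _; exact: ltW (archi_boundP (normr_ge0 _)).
have [N HN] := choice (fun k => arch (l k)).
exists (fun k => k * N k)%N => r r1.
have [k1 Hk1] := arch (r - 1)^-1; exists k1 => k k1k.
apply: le_trans (HN k) _.
have -> : r = 1 + (r - 1) by ring.
apply: le_trans (bernoulli_ge _ _); last by lra.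
have kr : 1 <= k%:R * (r - 1).
  have r0 : 0 < r - 1 by lra.
  rewrite -ler_pdivrMr // mul1r; apply: le_trans Hk1 _; by rewrite ler_nat.
apply: ler_wpDl => //; rewrite natrM mulrAC.
by rewrite ler_peMl.
Qed.

(** Such an element preserves a sequence of adjacent segments going to +oo, and on each
of them its support stays away from the end points. *)
Definition cofinally_trivial g :=
  forall b, exists p q, [/\ b < p, p < q & forall x, p <= x <= q -> g x = x].

End steinhaus.

Section steinhaus.
Context {R : realType}.
Local Notation G := (Homeo_plus (line_orientation R)).
Implicit Types g h f : G.

Lemma glue_eq (J : Type) (E : J -> R -> R) (hE : interval_family E) (c : J -> G) g :
  (forall j t, g (E j t) = E j (c j t)) ->
  (forall x, (forall j t, E j t <> x) -> g x = x) -> g = glue hE c.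
Proof.
move=> gin gout; apply: homeo_eq => x; case: (in_or_out E x) => [[j [t ->]]|out].
  by rewrite glue_in gin.
by rewrite glue_out // gout.
Qed.

Lemma sequence_unbounded (m : nat -> R) : (forall k, m k + 1 <= m k.+1) ->
  forall x, exists k, x < m k.
Proof.
move=> mS x.
have mk k : m 0%N + k%:R <= m k.
  elim: k => [|k IH]; first by rewrite addr0.
  by apply: le_trans (mS k); rewrite -natr1; lra.
exists (Num.bound `|x - m 0%N|); apply: lt_le_trans (mk _).
by have := archi_boundP (normr_ge0 (x - m 0%N)); have := ler_norm (x - m 0%N); lra.
Qed.

Lemma sequence_locate (m : nat -> R) : (forall k, m k + 1 <= m k.+1) ->
  forall x k0, m k0 <= x -> exists k, (k0 <= k)%N /\ m k <= x < m k.+1.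
Proof.
move=> mS x k0 k0x.
have [k xk] := sequence_unbounded mS x.
have [//|n xn nmin] := @ex_minnP (fun k => x < m k); first by exists k.
have pS k' : m k' < m k'.+1 by have := mS k'; lra.
case: n xn nmin => [|n] xn nmin.
  by have := increasing_nat pS (leq0n k0); lra.
exists n; split; last first.
  by rewrite xn andbT leNgt; apply/negP => /nmin; rewrite ltnn.
rewrite -ltnS ltnNge; apply/negP => /(increasing_nat pS); lra.
Qed.

(** The segments are bounded by fixed points m k in the middle of intervals of fixed
points. *)
Lemma cofinally_trivial_blocks g : cofinally_trivial g ->
  exists (m a b : nat -> R) (c : nat -> G), [/\ forall k, m k + 1 <= m k.+1,
    forall k, g (m k) = m k, forall k, right_of (a k) (c k), forall k, left_of (b k) (c k)
  & forall k t, g (segment_map (m k) (m k.+1) t) = segment_map (m k) (m k.+1) (c k t)].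
Proof.
move=> gtriv.
have [P HP] := choice gtriv; have [Q HQ] := choice HP.
pose s := fix s (k : nat) : R := if k is k'.+1 then Q (s k') + 1 else 0.
pose lo k := P (s k); pose hi k := Q (s k); pose m k := (lo k + hi k) / 2.
have lohi k : lo k < hi k by have [] := HQ (s k).
have hilo k : hi k + 1 < lo k.+1 by have [] := HQ (s k.+1).
have gfix k x : lo k <= x <= hi k -> g x = x by have [_ _] := HQ (s k); exact.
have gm k : g (m k) = m k by apply: (gfix k); have := lohi k; rewrite /m; lra.
have mS k : m k + 1 <= m k.+1.
  by have := lohi k; have := lohi k.+1; have := hilo k; rewrite /m; lra.
have pm k : m k < m k.+1 by have := mS k; lra.
have hD := sequence_family pm (fun k => lexx _).
set D := (fun k => segment_map (m k) (m k.+1)) in hD.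
have block (q : G) : (forall k, q (m k) = m k) -> forall k t, exists u, q (D k t) = D k u.
  move=> qm k t; have /andP[h1 h2] := segment_map_in t (pm k).
  have [|u <-] := @segment_map_onto R (m k) (m k.+1) (q (D k t)); last by exists u.
  by rewrite -{1}(qm k) -{1}(qm k.+1) !homeo_lt_mono h1.
have [c gc] := glue_onto hD (block g gm) (block _ (fun k => homeo_fixV (gm k))).
(* g is the identity near both ends of the segment k, so c k has bounded support *)
have mono k := le_mono (fun x y => @segment_map_lt R _ _ x y (pm k)).
have [a ca] : {a : nat -> R & forall k, right_of (a k) (c k)}.
  apply: (@choice _ _ (fun k u => right_of u (c k))) => k.
  have [u Du] := @segment_map_onto R (m k) (m k.+1) (hi k)
    ltac:(by have := lohi k; have := lohi k.+1; have := hilo k; rewrite /m; lra).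
  exists u => t; rewrite -(mono k) Du => th.
  apply: (interval_map_inj (hD.1 k)); rewrite -gc; apply: (gfix k).
  by rewrite th andbT; have /andP[] := segment_map_in t (pm k); have := lohi k; rewrite /m /D; lra.
have [b cb] : {b : nat -> R & forall k, left_of (b k) (c k)}.
  apply: (@choice _ _ (fun k u => left_of u (c k))) => k.
  have [u Du] := @segment_map_onto R (m k) (m k.+1) (lo k.+1)
    ltac:(by have := lohi k; have := lohi k.+1; have := hilo k; rewrite /m; lra).
  exists u => t; rewrite -(mono k) Du => th.
  apply: (interval_map_inj (hD.1 k)); rewrite -gc; apply: (gfix k.+1).
  by rewrite th /=; have /andP[] := segment_map_in t (pm k); have := lohi k.+1; rewrite /m /D; lra.
by exists m, a, b, c.
Qed.

Section contraction.
Context (D : nat -> R -> R) (hD : interval_family D).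
Context (A : nat -> set G) (covA : forall g, exists i, A i g).

(** The intervals of diagonal_extension are here the images under the D k of disjoint
segments of length 1, indexed by the pairs (n, m). *)
Lemma nested_words : exists (p : R) (pS : p < p + 1), forall c : nat -> G,
  (forall k, exists u v, c k = commutator u v) ->
  words 4 (quotients A) (glue hD (fun k => embed (interval_map_segment pS) (c k))).
Proof.
pose j0 (n m : nat) : R := (pickle (n, m))%:R.
have j0S n m : j0 n m < j0 n m + 1 by rewrite ltrDl.
have sep : interval_family (fun i : nat => segment_map i%:R (i%:R + 1) : R -> R).
  by apply: sequence_family => k0; rewrite ?ltrDl // natr1.
pose E n m k := D k \o segment_map (j0 n m) (j0 n m + 1).
have hE : interval_family (fun x : nat * nat * nat => E x.1.1 x.1.2 x.2).
  split => [x|]; first exact: interval_map_comp (hD.1 _) (interval_map_segment (j0S _ _)).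
  move=> [[n m] k] [[n' m'] k'] x y /= /(family_inj hD)[-> e].
  have /(pcan_inj pickleK)[-> ->//] := sep.2 (pickle (n, m)) (pickle (n', m')) x y e.
have [n [m Hnm]] := diagonal_extension (E := E) hE covA.
exists (j0 n m), (j0S n m) => c cc.
suff -> : glue hD (fun k => embed (interval_map_segment (j0S n m)) (c k)) =
  glue hE (fun x => if (x.1.1 == n) && (x.1.2 == m) then c x.2 else 1%g) by exact: Hnm.
apply: glue_eq => [[[n' m'] k] u|x out].
  rewrite [LHS](glue_in hD _ k) -[_ && _]/((n' == n) && (m' == m)).
  case: ifP => [/andP[/eqP -> /eqP ->]|ne]; first by rewrite embed_in.
  rewrite embed_out // => v ev.
  have [nn mm] : (n', m', k) = (n, m, k) by apply: (hE.2 _ _ u v); rewrite /E /= -ev.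
  by move: ne; rewrite nn mm !eqxx.
case: (in_or_out D x) => [[k [u xE]]|outD]; last by rewrite glue_out.
rewrite xE glue_in embed_out // => v ev.
by apply: (out (n, m, k) v); rewrite xE -ev.
Qed.

(** Dilations of ratios al ^+ e k, for 1 < al < 2, glue to uncountably many elements of G.
Two of them, of parameters al < be, lie in a common A_i, and r = be / al. *)
Lemma dilations_quotient (w : R) (e : nat -> nat) : exists (r : R) (r0 : 0 < r),
  1 < r /\ quotients A (glue hD (fun k => dilation w (exprn_gt0 (e k) r0))).
Proof.
pose spread (al : R) (al0 : 0 < al) := glue hD (fun k => dilation w (exprn_gt0 (e k) al0)).
have [x /andP[x1 _]|i [al [be [al1 alb _ [al0 Aal] [be0 Abe]]]]] :=
  @interval_pigeonhole R (fun i al => exists al0 : 0 < al, A i (spread al al0)) 1 2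
    ltac:(by lra).
  have x0 : 0 < x by lra.
  by have [i Ai] := covA (spread x x0); exists i, x0.
have r0 : 0 < be / al by rewrite divr_gt0.
exists (be / al), r0; split; first by rewrite ltr_pdivlMr // mul1r.
exists i, (spread al al0), (spread be be0); split=> //; split=> //.
rewrite /spread -glueV -glueM; congr glue; apply: funext => k; apply: homeo_eq => x.
apply: (@homeo_inj _ (dilation w (exprn_gt0 (e k) al0))).
rewrite homeo_mulE homeo_VK !dilationE exprMn exprVn.
have : al ^+ e k != 0 by rewrite expf_neq0 // gt_eqF.
by move=> h; field.
Qed.

(** By nested_words, there is inside each D k a smaller interval on which everything is
controlled, so it is enough to contract the supports of the c k into these smaller
intervals by a quotient. The one given by dilations_quotient has ratio r ^+ e k, for
some r > 1 that depends on e; growing_exponents provides an e for which this is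
eventually as large as needed, whatever r is. *)
Lemma tail_words (a b : nat -> R) (c : nat -> G) :
  (forall k, right_of (a k) (c k)) -> (forall k, left_of (b k) (c k)) ->
  exists k1, words 6 (quotients A) (glue hD (fun k => if (k1 <= k)%N then c k else 1%g)).
Proof.
move=> ca cb; have [p [pS Hp]] := nested_words.
pose w := p + 1 / 2.
pose l k := 4 * (`|a k - w| + `|b k - w|).
have [e He] := growing_exponents l.
have [r [r0 [r1 Vd]]] := dilations_quotient w e.
have [k1 Hk1] := He r r1; exists k1.
set d := glue hD _ in Vd; set t := glue hD _.
pose c' k := if (k1 <= k)%N then c k else 1%g.
pose dk k := dilation w (exprn_gt0 (e k) r0).
(* d dilates by a ratio at least 4 times the distances of w, the middle of
   ]p, p + 1[, to the ends of the support of c k: conjugation moves the support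
   into [w - 1/4, w + 1/4] *)
have small k : exists c0, ((dk k)^-1 * c' k * dk k)%g = embed (interval_map_segment pS) c0 /\
    exists u v, c0 = commutator u v.
  have pw : p < w - 1 / 4 by rewrite /w; lra.
  have ww : w - 1 / 4 < w + 1 / 4 by lra.
  have wp : w + 1 / 4 < p + 1 by rewrite /w; lra.
  apply: (segment_pullback_commutator pw ww wp).
    move=> x xw; rewrite !homeo_mulE /c'; case: ifP => k1k; last by rewrite homeo_KV.
    rewrite ca ?homeo_KV // dilationE.
    have h1 : l k <= r ^+ e k := Hk1 k k1k.
    have h2 : 4 * `|a k - w| <= r ^+ e k by have := normr_ge0 (b k - w); rewrite /l in h1; lra.
    have h3 : 1 / 4 <= w - x by lra.
    have h4 : (4 * `|a k - w|) * (1 / 4) <= r ^+ e k * (w - x).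
      by apply: ler_pM => //; rewrite ?mulr_ge0 //; lra.
    have := ler_norm (w - a k); rewrite distrC; lra.
  move=> x xw; rewrite !homeo_mulE /c'; case: ifP => k1k; last by rewrite homeo_KV.
  rewrite cb ?homeo_KV // dilationE.
  have h1 : l k <= r ^+ e k := Hk1 k k1k.
  have h2 : 4 * `|b k - w| <= r ^+ e k by have := normr_ge0 (a k - w); rewrite /l in h1; lra.
  have h3 : 1 / 4 <= x - w by lra.
  have h4 : (4 * `|b k - w|) * (1 / 4) <= r ^+ e k * (x - w).
    by apply: ler_pM => //; rewrite ?mulr_ge0 //; lra.
  by have := ler_norm (b k - w); lra.
have [c0 Hc0] := choice small.
have := Hp c0 (fun k => (Hc0 k).2); set y := glue hD _ => Vy.
have yE : y = (d^-1 * t * d)%g.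
  rewrite /d -glueV -!glueM; congr glue; apply: funext => k.
  by rewrite -(Hc0 k).1.
have -> : t = (d * y * d^-1)%g.
  by apply: homeo_eq => x; rewrite yE !homeo_mulE !homeo_VK.
apply: (@wordsM _ 5 1); last by apply: words1; exact: quotientsV.
by apply: (@wordsM _ 1 4) => //; exact: words1.
Qed.

End contraction.

Lemma trivial_tail_words (A : nat -> set G) g : (forall g, exists i, A i g) ->
  cofinally_trivial g -> exists t b, [/\ left_of b (g * t^-1)%g,
    (forall x, t x = g x \/ t x = x) & words 6 (quotients A) t].
Proof.
move=> covA /cofinally_trivial_blocks[m [a [b [c [mS gm ca cb gc]]]]].
have pm k : m k < m k.+1 by have := mS k; lra.
have hD := sequence_family pm (fun k => lexx _).
have [k1 Wt] := tail_words hD covA ca cb.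
pose c' k := if (k1 <= k)%N then c k else 1%g; pose t := glue hD c'.
have tg x : t x = g x \/ t x = x.
  case: (in_or_out (fun k => segment_map (m k) (m k.+1)) x) => [[k [u ->]]|out].
    by rewrite /t glue_in /c'; case: ifP => _; [left; rewrite gc|right].
  by right; rewrite /t glue_out.
exists t, (m k1); split=> //.
suff tx x : m k1 <= x -> t x = g x.
  move=> x xm; rewrite homeo_mulE -tx ?homeo_VK // -[m k1](_ : (t^-1)%g (m k1) = _) ?homeo_le_mono //.
  by apply: homeo_fixV; rewrite tx.
move=> xm; have [k [k1k /andP[kx xk]]] := sequence_locate mS xm.
have [->|nx] := eqVneq x (m k).
  by rewrite gm; have [->|] := tg (m k).
have [u <-] := @segment_map_onto R (m k) (m k.+1) x
  ltac:(by rewrite xk andbT lt_neqAle eq_sym nx).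
by rewrite gc [LHS](glue_in hD c' k) /c' k1k.
Qed.

End steinhaus.

Section steinhaus.
Context {R : realType}.
Local Notation G := (Homeo_plus (line_orientation R)).
Implicit Types g h f : G.

(** The factor g2 agrees with g on far away segments and is the identity on others;
on the images of the former, the cofactor is the identity. *)
Lemma cofinally_trivial_factor g a : right_of a g -> exists g2 : G,
  [/\ right_of a g2, cofinally_trivial g2 & cofinally_trivial (g * g2^-1)%g].
Proof.
move=> ga.
have step b : exists x : R * R * G, let s := x.1.1 in let c := x.1.2 in let q := x.2 in
    [/\ b < s /\ s + 1 < c, right_of b q, left_of c q & forall x, s <= x <= s + 1 -> q x = g x].
  pose s := Num.max b ((g^-1)%g b) + 1.
  pose c := Num.max (s + 1) (g (s + 1)) + 1.
  have h1 : b <= Num.max b ((g^-1)%g b) by rewrite le_max lexx.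
  have h2 : (g^-1)%g b <= Num.max b ((g^-1)%g b) by rewrite le_max lexx orbT.
  have h3 : s + 1 <= Num.max (s + 1) (g (s + 1)) by rewrite le_max lexx.
  have h4 : g (s + 1) <= Num.max (s + 1) (g (s + 1)) by rewrite le_max lexx orbT.
  have bgs : b < g s by rewrite -(homeo_lt_mono (g^-1)%g) homeo_KV /s; lra.
  have [q [q1 q2 q3]] := @truncate R g b s (s + 1) c
    ltac:(by rewrite /s; lra) bgs ltac:(by lra) ltac:(by rewrite /c; lra) ltac:(by rewrite /c; lra).
  by exists (s, c, q); split => //=; split; rewrite /c /s in h3 *; lra.
have [F HF] := choice step.
pose b := fix b (k : nat) : R := if k is k'.+1 then (F (b k')).1.2 + 1 else a.
pose s k := (F (b k)).1.1; pose c k := (F (b k)).1.2; pose q k := (F (b k)).2.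
have HFk k : [/\ b k < s k /\ s k + 1 < c k, right_of (b k) (q k), left_of (c k) (q k) &
  forall x, s k <= x <= s k + 1 -> q k x = g x] by exact: HF.
have bc k : b k < c k by have [[? ?] _ _ _] := HFk k; lra.
have bS k : b k.+1 = c k + 1 by [].
have bS1 k : b k + 1 <= b k.+1 by have [[? ?] _ _ _] := HFk k; rewrite bS; lra.
have cb k : c k <= b k.+1 by rewrite bS; lra.
have hD := sequence_family bc cb.
set D := (fun k => segment_map (b k) (c k)) in hD.
have Q k : {cc : G | q k = embed (interval_map_segment (bc k)) cc}.
  apply: cid; have [_ h1 h2 _] := HFk k; apply: embed_onto => x out.
  have [/h1//|bx] := leP x (b k); have [/h2//|xc] := leP (c k) x.
  have [t et] := @segment_map_onto R (b k) (c k) x ltac:(by rewrite bx xc).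
  by case: (out t).
pose g2 := glue hD (fun k => sval (Q k)).
have g2D k t : g2 (D k t) = q k (D k t).
  by rewrite /g2 glue_in; have := svalP (Q k) => {2}->; rewrite embed_in.
have pb k : b k < b k.+1 by have := bS1 k; lra.
exists g2; split.
- move=> x xa; rewrite /g2 glue_out // => k t e.
  have /andP[h _] := segment_map_in t (bc k).
  have := increasing_nat pb (leq0n k); rewrite -/(D k t) e in h => h'.
  by move: (lt_le_trans h xa); rewrite ltNge h'.
- move=> y; have [k yk] := sequence_unbounded bS1 y.
  exists (c k), (b k.+1); split; first by have := bc k; lra.
    by rewrite bS; lra.
  move=> x /andP[cx xb]; rewrite /g2 glue_out // => j t e.
  have /andP[h1 h2] := segment_map_in t (bc j); rewrite -/(D j t) e in h1 h2.
  have [jk|kj] := leqP j k.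
    have := increasing_nat pb (jk : (j.+1 <= k.+1)%N); rewrite !bS; lra.
  by have := increasing_nat pb kj; lra.
- move=> y; have [k yk] := sequence_unbounded bS1 ((g^-1)%g y).
  have [[h1 h2] _ _ h3] := HFk k.
  exists (g (s k)), (g (s k + 1)); split.
  + by rewrite -(homeo_lt_mono (g^-1)%g) homeo_KV; lra.
  + by rewrite homeo_lt_mono; lra.
  + move=> x /andP[x1 x2]; pose u := (g^-1)%g x.
    have gu : g u = x by rewrite /u homeo_VK.
    have hu : s k <= u <= s k + 1 by rewrite -(homeo_le_mono g (s k) u) -(homeo_le_mono g u (s k + 1)) gu x1.
    have [t et] := @segment_map_onto R (b k) (c k) u ltac:(by lra).
    have g2u : g2 u = x by rewrite -et -/(D k t) g2D /D et h3 // gu.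
    by rewrite homeo_mulE -[in X in g X]g2u homeo_KV.
Qed.

(** Each of the two cofinally trivial factors of g is a bounded element, of length 4,
times a tail, of length 6. *)
Lemma ray_words (A : nat -> set G) : (forall g, exists i, A i g) ->
  exists a, forall g, right_of a g -> words 20 (quotients A) g.
Proof.
move=> covA; have [a Ha] := bounded_words covA; exists a => g ga.
have half h : right_of a h -> cofinally_trivial h -> words 10 (quotients A) h.
  move=> ha htriv; have [t [b [lb tg Wt]]] := trivial_tail_words covA htriv.
  have -> : h = ((h * t^-1) * t)%g by rewrite -mulgA mulVg mulg1.
  apply: (@wordsM _ 4 6) => //; apply: Ha lb; apply: right_ofM => //.
  by apply: right_ofV => x xa; have [->|//] := tg x; exact: ha.
have [g2 [g2a g2t gg2]] := cofinally_trivial_factor ga.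
have -> : g = ((g * g2^-1) * g2)%g by rewrite -mulgA mulVg mulg1.
by apply: (@wordsM _ 10 10); apply: half => //; apply: right_ofM => //; exact: right_ofV.
Qed.

(** * Large subgroups *)

Definition is_subgroup (S : set G) := [/\ S 1%g, forall g, S g -> S (g^-1)%g
  & forall g h, S g -> S h -> S (g * h)%g].

Lemma words_subgroup (S : set G) n (V : set G) : is_subgroup S -> V `<=` S ->
  words n V `<=` S.
Proof.
move=> [S1 _ SM] VS; elim: n => [|n IH] w /=; first by move=> ->.
by move=> [u [v [/VS Vu [/IH Sv ->]]]]; exact: SM.
Qed.

Lemma ray_subgroup (S : set G) (A : nat -> set G) : is_subgroup S ->
  (forall g, exists i, A i g) -> (forall i g h, A i g -> A i h -> S (g^-1 * h)%g) ->
  exists a, forall g, right_of a g -> S g.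
Proof.
move=> gS covA AS; have [a Ha] := ray_words covA; exists a => g /Ha.
by apply: words_subgroup => // w [i [u [v [Au [Av ->]]]]]; exact: AS Au Av.
Qed.

Lemma reflect_left b g : left_of b g -> right_of (- b) (embed (@interval_map_opp R) g).
Proof. by move=> gb x xb; rewrite -[x]opprK embed_in gb // lerNr. Qed.

Lemma embed_subgroup e (he : interval_map e) (S : set G) : is_subgroup S ->
  is_subgroup [set g | S (embed he g)].
Proof.
move=> [S1 SV SM]; split => /=; first by rewrite embed1.
  by move=> g /SV; rewrite embedV.
by move=> g h Sg Sh; rewrite embedM; exact: SM.
Qed.

Lemma reflectK g : embed (@interval_map_opp R) (embed (@interval_map_opp R) g) = g.
Proof.
by apply: homeo_eq => x; rewrite -[x in LHS]opprK embed_in -[in LHS](opprK x) embed_in !opprK.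
Qed.

Lemma ray_subgroup_left (S : set G) (A : nat -> set G) : is_subgroup S ->
  (forall g, exists i, A i g) -> (forall i g h, A i g -> A i h -> S (g^-1 * h)%g) ->
  exists b, forall g, left_of b g -> S g.
Proof.
move=> gS covA AS; pose he := @interval_map_opp R.
have [|g|i g h|a Ha] := @ray_subgroup [set g | S (embed he g)] (fun i => [set g | A i (embed he g)]).
- exact: embed_subgroup.
- exact: covA.
- by move=> /= Ag Ah; rewrite embedM embedV; exact: AS Ag Ah.
exists (- a) => g /reflect_left; rewrite opprK => /Ha /=.
by rewrite reflectK.
Qed.

Lemma fix_factor g t : g t = t -> exists h k : G,
  [/\ left_of t h, right_of t k & g = (h * k)%g].
Proof.
move=> gt.
have [h [h1 h2]] := @homeo_cat R g 1%g t gt.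
have [k [k1 k2]] := @homeo_cat R 1%g g t (esym gt).
exists h, k; split => //; apply: homeo_eq => x; rewrite homeo_mulE.
have [xt|tx] := leP x t; first by rewrite k1 // h1.
by rewrite k2 ?h2 ?(ltW tx) // -{1}gt homeo_le_mono ltW.
Qed.

Lemma homeo_move a b s s' : a < s < b -> a < s' < b ->
  exists g : G, [/\ right_of a g, left_of b g & g s = s'].
Proof.
move=> sab s'ab; have ab : a < b by lra.
have [x ex] := segment_map_onto sab; have [x' ex'] := segment_map_onto s'ab.
exists (embed (interval_map_segment ab) (translation (x' - x))); split.
- by move=> y ya; apply: embed_out => t e; have := segment_map_in t ab; rewrite e; lra.
- by move=> y yb; apply: embed_out => t e; have := segment_map_in t ab; rewrite e; lra.
- by rewrite -ex embed_in translationE addrC subrK.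
Qed.

(** Composing with an element supported in one of the rays, one can bring g to fix
the middle of [a, b]; it then splits into elements of the two rays. *)
Lemma overlapping_rays (S : set G) a b : is_subgroup S -> a < b ->
  (forall g, right_of a g -> S g) -> (forall g, left_of b g -> S g) -> forall g, S g.
Proof.
move=> [S1 SV SM] ab Sa Sb g; pose c := (a + b) / 2.
have Sc h : h c = c -> S h.
  move=> /fix_factor[u [v [uc vc ->]]]; apply: SM.
    by apply: Sb; apply: left_of_le uc; rewrite /c; lra.
  by apply: Sa; apply: right_of_le vc; rewrite /c; lra.
suff [h [Sh hgc]] : exists h, S h /\ h (g c) = c.
  have -> : g = (h^-1 * (h * g))%g by rewrite mulgA mulVg mul1g.
  by apply: SM; [exact: SV|apply: Sc; rewrite homeo_mulE].
have [gcb|bgc] := ltP (g c) b.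
  have [h [_ hb hc]] := @homeo_move (Num.min a (g c) - 1) b (g c) c
    ltac:(by rewrite gcb andbT; have := ge_min (g c) a (g c); rewrite lexx orbT => H; lra)
    ltac:(by have := ge_min a a (g c); rewrite lexx /= /c; lra).
  by exists h; split => //; apply: Sb.
have [h [ha _ hc]] := @homeo_move a (g c + 1) (g c) c
  ltac:(by lra) ltac:(by rewrite /c; lra).
by exists h; split => //; apply: Sa.
Qed.

(** The hypotheses say that S has countable index. It contains the elements supported
in two opposite rays. If no element of S moves b beyond a, then S fixes the
supremum r of the orbit of b, but an uncountable group of translations moves r to
distinct points, so that some nontrivial translation is in S. Otherwise, conjugation
moves one of the rays until they overlap. *)
Lemma countable_index_full (S : set G) (A : nat -> set G) : is_subgroup S ->
  (forall g, exists i, A i g) -> (forall i g h, A i g -> A i h -> S (g^-1 * h)%g) ->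
  forall g, S g.
Proof.
move=> gS covA AS; have [S1 SV SM] := gS.
have [a Sa] := ray_subgroup gS covA AS.
have [b Sb] := ray_subgroup_left gS covA AS.
suff [s [Ss sb]] : exists s, S s /\ a < s b.
  apply: (overlapping_rays gS sb Sa) => g gb.
  have -> : g = (s * (s^-1 * g * s) * s^-1)%g.
    by apply: homeo_eq => x; rewrite !homeo_mulE !homeo_VK.
  apply: (SM); last exact: SV.
  apply: (SM) => //; apply: Sb => x bx.
  by rewrite !homeo_mulE gb ?homeo_KV // homeo_le_mono.
apply: contrapT => no.
pose T := [set y | exists2 s, S s & y = s b].
have ubT : ubound T a.
  by move=> y [s Ss ->]; rewrite leNgt; apply/negP => h; apply: no; exists s.
have supT : has_sup T by split; [exists b, 1%g|exists a].
set r := sup T.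
have inv s : S s -> r <= s r.
  move=> Ss; apply: ge_sup; first by exists b, 1%g.
  move=> y [s' Ss' ->]; rewrite -(homeo_le_mono (s^-1)%g) homeo_KV -homeo_mulE.
  by apply: ub_le_sup; [exists a|exists (s^-1 * s')%g => //; apply: SM => //; exact: SV].
have fixr s : S s -> s r = r.
  move=> Ss; apply/eqP; rewrite eq_le inv // andbT.
  by rewrite -(homeo_le_mono (s^-1)%g) homeo_KV; apply/inv/SV.
have [i [x [y [_ xy _ Ax Ay]]]] := @interval_pigeonhole R
  (fun i x => A i (translation x)) 0 1 ltr01 (fun x _ => covA (translation x)).
have := fixr _ (AS _ _ _ Ax Ay).
by rewrite -translationN -translationD translationE; lra.
Qed.

(** An element of S that moves t conjugates the ray that ends at t into an
overlapping one. *)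
Lemma stabilizer_maximal (S : set G) t : is_subgroup S ->
  (forall g, g t = t -> S g) -> (exists g, S g /\ g t <> t) -> forall g, S g.
Proof.
move=> gS St [s [Ss st]]; have [S1 SV SM] := gS.
suff [s0 [Ss0 ts0]] : exists s0, S s0 /\ t < s0 t.
  apply: (overlapping_rays gS ts0) => g gt; first by apply: St; apply: gt.
  have -> : g = (s0 * (s0^-1 * g * s0) * s0^-1)%g.
    by apply: homeo_eq => x; rewrite !homeo_mulE !homeo_VK.
  apply: (SM); last exact: SV.
  by apply: (SM) => //; apply: St; rewrite !homeo_mulE gt ?homeo_KV.
have [h|h|/esym//] := ltgtP t (s t); first by exists s.
exists (s^-1)%g; split; first exact: SV.
by rewrite -(homeo_lt_mono s) homeo_VK.
Qed.

End steinhaus.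

(** * Commuting actions on the line *)

Section orbit_hull.
Context {R : realType}.
Implicit Types (x y z : R) (f j : R -> R).

(** The convex hull of the orbit of x, when x < f x and f' is the inverse of f. Its points
are the y that can be reached by iterating, so that no limits are involved. *)
Definition orbit_hull f (f' : R -> R) x y := exists n, iter n f' x < y < iter n f x.

Section one.
Context f (f' : R -> R) (fK : cancel f f') (f'K : cancel f' f).
Context (flt : {homo f : x y / x < y}).

Lemma iter_lt n : {homo iter n f : x y / x < y}.
Proof. by elim: n => [//|n IH] x y xy /=; apply/flt/IH. Qed.

Lemma inv_lt : {homo f' : x y / x < y}.
Proof. exact: increasing_inv f'K flt. Qed.

Lemma iterK n : cancel (iter n f) (iter n f').
Proof. by elim: n => [//|n IH] x; rewrite iterSr iterS fK IH. Qed.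

Lemma iter_increasing x : x < f x -> forall m n, (m <= n)%N -> iter m f x <= iter n f x.
Proof.
move=> xf m n /subnK <-; elim: (n - m)%N => [//|k IH].
apply: le_trans IH _; rewrite addSn iterSr.
by apply: ltW; apply: iter_lt.
Qed.
End one.

Context f (f' : R -> R) (fK : cancel f f') (f'K : cancel f' f).
Context (flt : {homo f : x y / x < y}).
Let f'lt := inv_lt f'K flt.

Lemma orbit_hull_refl x : x < f x -> orbit_hull f f' x x.
Proof. by move=> xf; exists 1%N => /=; rewrite xf andbT -[X in _ < X]fK; apply: f'lt. Qed.

Lemma orbit_hull_next x y : x < y -> y < f x -> orbit_hull f f' x y.
Proof.
move=> xy yf; have xf := lt_trans xy yf; exists 1%N; rewrite /= yf andbT.
by apply: lt_trans xy; rewrite -[X in _ < X]fK; apply: f'lt.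
Qed.

Lemma orbit_hull_sym x y : orbit_hull f f' x y -> orbit_hull f f' y x.
Proof.
move=> [n /andP[h1 h2]]; exists n; apply/andP; split.
  by rewrite -[X in _ < X](iterK fK n); apply: (iter_lt f'lt).
by rewrite -[X in X < _](iterK f'K n); apply: (iter_lt flt).
Qed.

Lemma orbit_hull_trans x y z : orbit_hull f f' x y -> orbit_hull f f' y z ->
  orbit_hull f f' x z.
Proof.
move=> [n /andP[h1 h2]] [m /andP[h3 h4]]; exists (m + n)%N; rewrite !iterD.
by apply/andP; split; [apply: lt_trans h3; apply: (iter_lt f'lt)|apply: lt_trans h4 _; apply: (iter_lt flt)].
Qed.

(** The point y lies between two consecutive points of the orbit of x. *)
Lemma orbit_hull_moved x y : x < f x -> orbit_hull f f' x y -> y < f y.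
Proof.
move=> xf [n /andP[h1 h2]].
pose u i := iter i f (iter n f' x).
have u2n : y < u (n + n)%N by rewrite /u iterD (iterK f'K).
have [|i yi imin] := @ex_minnP (fun i => y < u i); first by exists (n + n)%N.
case: i yi imin => [|i] yi imin; first by move: (lt_trans yi h1); rewrite ltxx.
apply: lt_le_trans yi _; rewrite /u /= (le_mono flt) leNgt; apply/negP => /imin.
by rewrite ltnn.
Qed.

Lemma orbit_hull_convex x y1 y2 y : x < f x -> orbit_hull f f' x y1 ->
  orbit_hull f f' x y2 -> y1 <= y -> y <= y2 -> orbit_hull f f' x y.
Proof.
move=> xf [n /andP[h1 h2]] [m /andP[h3 h4]] y1y yy2; exists (n + m)%N.
have xf' : f' x < x by rewrite -[X in _ < X]fK; apply: f'lt.
apply/andP; split.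
  apply: le_lt_trans (lt_le_trans h1 y1y).
  elim: m {h3 h4} => [|m IH]; first by rewrite addn0.
  by rewrite addnS iterSr; apply: le_trans IH; apply: ltW; apply: (iter_lt f'lt).
apply: lt_le_trans (le_lt_trans yy2 h4) _.
by apply: (iter_increasing flt) => //; exact: leq_addl.
Qed.

Lemma orbit_hull_comm j x y : {homo j : x y / x < y} -> (forall z, j (f z) = f (j z)) ->
  orbit_hull f f' x y -> orbit_hull f f' (j x) (j y).
Proof.
move=> jlt jf [n /andP[h1 h2]]; exists n.
have jf' z : j (f' z) = f' (j z) by rewrite -[in RHS](f'K z) jf fK.
have it (g : R -> R) : (forall z, j (g z) = g (j z)) -> forall z, iter n g (j z) = j (iter n g z).
  by move=> jg z; elim: n {h1 h2} => [//|k IH]; rewrite !iterS jg IH.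
by rewrite !it // !jlt.
Qed.

End orbit_hull.

Section commuting_actions.
Context {R : realType}.
Local Notation G := (Homeo_plus (line_orientation R)).
Implicit Types (g h : G) (al be : G -> R -> R).

Definition increasing_action al := [/\ forall x, al 1%g x = x,
  forall g h x, al (g * h)%g x = al g (al h x) & forall g, {homo al g : x y / x < y}].

Lemma increasing_actionK al g : increasing_action al -> cancel (al g) (al (g^-1)%g).
Proof. by move=> [a1 aM _] x; rewrite -aM mulVg a1. Qed.

Lemma increasing_actionVK al g : increasing_action al -> cancel (al (g^-1)%g) (al g).
Proof. by move=> [a1 aM _] x; rewrite -aM mulgV a1. Qed.

Definition action_hull al g := orbit_hull (al g) (al (g^-1)%g).

(** The action be permutes the hulls of orbits of al g. These are open and equal or
disjoint, hence separated by rational numbers; so the stabilizer of one of them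
has countable index and is everything. *)
Lemma action_hull_invariant al be g x : increasing_action al -> increasing_action be ->
  (forall g h y, al g (be h y) = be h (al g y)) -> x < al g x ->
  forall h, action_hull al g x (be h x).
Proof.
move=> Al Be comm xg; have [b1 bM blt] := Be.
have gK := increasing_actionK g Al; have gVK := increasing_actionVK g Al.
have [_ _ alt] := Al; have glt := alt g.
have bhull h u v : action_hull al g u v -> action_hull al g (be h u) (be h v).
  by apply: orbit_hull_comm => // z; rewrite comm.
have tr := @orbit_hull_trans R _ _ gVK glt.
have sy := @orbit_hull_sym R _ _ gK gVK glt.
pose S : set G := [set h | action_hull al g x (be h x)].
have gS : is_subgroup S.
  split; first by rewrite /S /= b1; exact: (orbit_hull_refl gK gVK glt).
  - by move=> h /(bhull (h^-1)%g); rewrite (increasing_actionK h Be) => /sy.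
  - by move=> h k Sh /(bhull h) Sk; rewrite /S /= bM; exact: tr Sk.
pose A (i : nat) : set G := [set h | exists q : rat, unpickle i = Some q /\
  action_hull al g (be h x) (ratr q)].
apply: (@countable_index_full R S A gS) => [h|i h k /= [q [iq hq]] [q' [iq' kq]]].
  have [q _] : exists2 q : rat, True & be h x < ratr q < be h (al g x).
    have [q] := rat_in_itvoo (blt h _ _ xg).
    by rewrite in_itv /= => hq; exists q.
  rewrite -comm => /andP[q1 q2]; exists (pickle q), q; split; first exact: pickleK.
  exact: orbit_hull_next.
move: iq' kq; rewrite iq => -[<-] kq.
rewrite /S /= bM -[x in action_hull _ _ x](increasing_actionK h Be).
by apply: bhull; apply: tr hq _; exact: sy.
Qed.

(** The hull for be h contains the orbit of x under al g, since it is invariant under al,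
and it is convex. *)
Lemma action_hull_sub al be g h x y : increasing_action al -> increasing_action be ->
  (forall g h y, al g (be h y) = be h (al g y)) -> x < al g x -> x < be h x ->
  action_hull al g x y -> action_hull be h x y.
Proof.
move=> Al Be comm xg xh [n /andP[h1 h2]].
have inv := action_hull_invariant Be Al (fun g h y => esym (comm h g y)) xh.
have itM (k : G) m : exists k', forall z, iter m (al k) z = al k' z.
  have [a1 aM _] := Al.
  elim: m => [|m [k' IH]]; first by exists 1%g => z; rewrite a1.
  by exists (k * k')%g => z; rewrite /= IH aM.
have [k1 hk1] := itM (g^-1)%g n; have [k2 hk2] := itM g n.
have [_ _ blt] := Be.
apply: (orbit_hull_convex (increasing_actionK h Be) (increasing_actionVK h Be) (blt h) xh
  (inv k1) (inv k2)); apply: ltW.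
- by rewrite -hk1.
- by rewrite -hk2.
Qed.

(** All the hulls of x, for elements of either action moving x, are equal, and an
element that moves x moves all points of its hull in the same direction. But if
s moves x to the right and b conjugates s to its square, then b moves far
iterates of s^-1 at x to the left and far iterates of s at x to the right. *)
Lemma commuting_actions_square al be g (s b : G) x :
  increasing_action al -> increasing_action be ->
  (forall g h y, al g (be h y) = be h (al g y)) ->
  (b * s = s * s * b)%g -> al g x <> x -> be s x <> x -> False.
Proof.
move=> Al Be comm.
wlog xg : g / x < al g x.
  move=> W bs gx sx; have [h|h|h] := ltgtP x (al g x); last by rewrite -h in gx.
    exact: W h bs gx sx.
  have h' : x < al (g^-1)%g x.
    by rewrite -[X in X < _](increasing_actionK g Al); have [_ _ ] := Al; apply.
  by apply: (W _ h' bs _ sx) => e; rewrite e ltxx in h'.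
move=> + _; wlog xs : s / x < be s x.
  move=> W bs sx; have [h|h|h] := ltgtP x (be s x); last by rewrite -h in sx.
    exact: W h bs sx.
  have h' : x < be (s^-1)%g x.
    by rewrite -[X in X < _](increasing_actionK s Be); have [_ _ ] := Be; apply.
  apply: (W _ h') => [|e]; last by rewrite e ltxx in h'.
  apply: homeo_eq => y; apply: (@homeo_inj _ s); apply: (@homeo_inj _ s).
  have := congr1 (fun q : G => q ((s^-1)%g y)) bs.
  by rewrite !homeo_mulE !homeo_VK => ->.
move=> bs _.
have [b1 bM blt] := Be; have [a1 aM alt] := Al.
have gK := increasing_actionK g Al; have gVK := increasing_actionVK g Al.
have sK := increasing_actionK s Be; have sVK := increasing_actionVK s Be.
have comm' := fun g h y => esym (comm h g y).
have sb y : be b (be s y) = be s (be s (be b y)) by rewrite -!bM bs.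
(* if b fixes x then it moves s x *)
wlog xb : x xg xs / be b x <> x.
  move=> W; have [bx|] := pselect (be b x = x); last exact: W.
  apply: (W (be s x)).
  - apply: (orbit_hull_moved gVK (alt g) xg).
    exact: (action_hull_invariant Al Be comm xg s).
  - exact: blt.
  - by rewrite sb bx => /(can_inj sK) e; rewrite e ltxx in xs.
have hullg j := action_hull_invariant Al Be comm xg j.
have its m : exists k', forall z, iter m (be s) z = be k' z.
  elim: m => [|m [k' IH]]; first by exists 1%g => z; rewrite b1.
  by exists (s * k')%g => z; rewrite /= IH bM.
have itsV m : exists k', forall z, iter m (be (s^-1)%g) z = be k' z.
  elim: m => [|m [k' IH]]; first by exists 1%g => z; rewrite b1.
  by exists (s^-1 * k')%g => z; rewrite /= IH bM.
have [n /andP[n1 n2]] : orbit_hull (be s) (be (s^-1)%g) x (be b x).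
  exact: (action_hull_sub Al Be comm xg xs (hullg b)).
have sb_it m y : be b (iter m (be s) y) = iter m (be s) (iter m (be s) (be b y)).
  elim: m => [//|m IH]; rewrite [iter m.+1 _ y]iterS sb IH [in RHS]iterS.
  by congr (be s _); rewrite -iterS iterSr.
have sltn m := @iter_lt R _ (blt s) m.
have [xlt|xlt|e] := ltgtP x (be b x); last by rewrite -e in xb.
- pose z := iter n (be (s^-1)%g) x.
  have bz : be b z < z.
    rewrite -(leW_mono (le_mono (@iter_lt R _ (blt s) n))) -(leW_mono (le_mono (@iter_lt R _ (blt s) n))).
    rewrite -sb_it /z (iterK sVK) //; exact: n2.
  have [k' hk'] := itsV n.
  have : z < be b z.
    apply: (orbit_hull_moved (increasing_actionVK b Be) (blt b) xlt).
    by apply: (action_hull_sub Al Be comm xg xlt); rewrite /z hk'; exact: hullg.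
  by rewrite ltNge (ltW bz).
- have xlt' : x < be (b^-1)%g x.
    by rewrite -[X in X < _](increasing_actionK b Be); apply: blt.
  pose z := iter n (be s) x.
  have bz : z < be b z.
    rewrite /z sb_it; apply: (sltn n).
    by rewrite -[X in X < _](iterK sVK n); apply: (sltn n).
  have [k' hk'] := its n.
  have : z < be (b^-1)%g z.
    apply: (orbit_hull_moved (increasing_actionK b Be) (blt _) xlt').
    have := @action_hull_sub al be g (b^-1)%g x z Al Be comm xg xlt'.
    by rewrite /action_hull invgK; apply; rewrite /z hk'; exact: hullg.
  move=> /(blt b); rewrite (increasing_actionVK b Be) => h.
  by move: (lt_trans bz h); rewrite ltxx.
Qed.

(** The element h is a product of conjugates of a translation and of its inverse
(bounded_commutator), and the dilation of ratio 2 conjugates a translation to its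
square. *)
Lemma commuting_actions_trivial al be g h a b x :
  increasing_action al -> increasing_action be ->
  (forall g h y, al g (be h y) = be h (al g y)) ->
  al g x <> x -> a < b -> right_of a h -> left_of b h -> be h x = x.
Proof.
move=> Al Be comm gx ab ha hb.
have [k [L [L0 ->]]] := bounded_commutator ab ha hb.
pose d : G := dilation 0 (ltr0Sn R 1).
have dT : (d * translation L = translation L * translation L * d)%g.
  by apply: homeo_eq => y; rewrite !homeo_mulE !translationE !dilationE; ring.
have fixT (u c : G) : (c * u = u * u * c)%g -> be u x = x.
  by move=> cu; apply: contrapT; exact: (commuting_actions_square Al Be comm cu gx).
have [b1 bM _] := Be.
have f1 : be (translation L) x = x by exact: fixT dT.
have f2 : be (k * translation L * k^-1)%g x = x.
  apply: (fixT _ (k * d * k^-1)%g); apply: homeo_eq => y.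
  rewrite !homeo_mulE !homeo_KV; congr (homeo_fun k _).
  exact: (congr1 (fun q : G => q ((k^-1)%g y)) dT).
rewrite bM -[in LHS]f1 (increasing_actionK _ Be); exact: f2.
Qed.

End commuting_actions.

(** * Continuity of actions on manifolds *)

Section continuity.
Context {R : realType} {M : topologicalType} {O : orientation R M}.
Local Notation G := (Homeo_plus (line_orientation R)).
Implicit Types (g h : G) (psi : G -> Homeo_plus O) (x y : M).

Definition is_hom psi := forall g h, psi (g * h)%g = (psi g * psi h)%g.

Lemma hom1 psi : is_hom psi -> psi 1%g = 1%g.
Proof. by move=> hpsi; apply: (@mulgI _ (psi 1%g)); rewrite -hpsi !mulg1. Qed.

Lemma hom_mulE psi g h x : is_hom psi -> psi (g * h)%g x = psi g (psi h x).
Proof. by move=> ->. Qed.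

Lemma hom_KV psi g x : is_hom psi -> psi (g^-1)%g (psi g x) = x.
Proof. by move=> hpsi; rewrite -hom_mulE // mulVg hom1. Qed.

Lemma hom_VK psi g x : is_hom psi -> psi g (psi (g^-1)%g x) = x.
Proof. by move=> hpsi; rewrite -hom_mulE // mulgV hom1. Qed.

Lemma hom_embed psi e (he : interval_map e) : is_hom psi -> is_hom (psi \o embed he).
Proof. by move=> hpsi g h /=; rewrite embedM hpsi. Qed.

Lemma stabilizer_subgroup psi x : is_hom psi -> is_subgroup [set g | psi g x = x].
Proof.
move=> hpsi; split => /=; first by rewrite hom1.
  by move=> g gx; rewrite -[in LHS]gx hom_KV.
by move=> g h gx hx; rewrite hom_mulE // hx.
Qed.

Lemma countable_basis_sequence : @second_countable M -> exists B : nat -> set M,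
  (forall n, open (B n)) /\ forall x U, nbhs x U -> exists n, B n x /\ B n `<=` U.
Proof.
move=> [Bs /countable_injP[f finj] [Bopen Bbasis]].
exists (fun n => \bigcup_(b in [set b | Bs b /\ f b = n]) b); split.
  by move=> n; apply: bigcup_open => b [/Bopen].
move=> x U /(Bbasis x)[b [Bb bx] bU]; exists (f b); split; first by exists b.
move=> y [b' [Bb' fb]] b'y; apply: bU => /=.
by rewrite (finj b b') ?inE.
Qed.

Lemma image_compact_cover (B : nat -> set M) (k : R -> M) (K : set R) (W : set M) :
  (forall n, open (B n)) -> (forall x U, nbhs x U -> exists n, B n x /\ B n `<=` U) ->
  continuous k -> compact K -> open W -> k @` K `<=` W ->
  exists l : seq nat, k @` K `<=` \bigcup_(n in [set` l]) B n /\
    \bigcup_(n in [set` l]) B n `<=` W.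
Proof.
move=> oB hB ck; rewrite compact_cover => cK oW KW.
have [|t Kt|D' D'D KD'] := cK nat [set n | B n `<=` W] (fun n => k @^-1` B n).
- by move=> n _; apply: open_comp => // t _; exact: ck.
- have Wt : W (k t) by apply: KW; exists t.
  by have [n [nt nW]] := hB _ W (open_nbhs_nbhs (conj oW Wt)); exists n.
exists (finmap.enum_fset D'); split; first by move=> _ [t /KD'[n nD' nt] <-]; exists n.
by move=> y [n nD' ny]; have := D'D n nD'; rewrite inE; apply.
Qed.

Lemma homeo_image_open (k : Homeo_plus O) (U : set M) : open U -> open (k @` U).
Proof.
move=> oU; have -> : k @` U = homeo_inv k @^-1` U.
  apply/seteqP; split=> y /=; first by move=> [z Uz <-]; rewrite homeo_funK.
  by move=> Uy; exists (homeo_inv k y) => //; rewrite homeo_invK.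
by apply: open_comp => // z _; exact: homeo_inv_continuous.
Qed.

Lemma chart_image_open (e : R -> M) (U : set R) : chart e -> open U -> open (e @` U).
Proof.
move=> ce oU; rewrite openE => y [t Ut <-] /=.
by apply: chart_nbhs => //; exact: open_nbhs_nbhs.
Qed.

(** The cover to which ray_words is applied: along a chain of 21 concentric arcs
around e t0, an element g is classified by finite unions of basic open sets that
separate the image of each arc from the complement of the image of the next one.
If u and v are classified alike, u^-1 * v maps each arc into the next one, so
products of 20 such quotients map the first arc into the last. *)
Lemma ray_orbit_near psi (e : R -> M) t0 (U : set M) : @second_countable M -> is_hom psi ->
  chart e -> nbhs (e t0) U -> exists a r : R, 0 < r /\
    forall g, right_of a g -> forall t, `|t - t0| <= r -> U (psi g (e t)).
Proof.
move=> scM hpsi ce Ue; have [B [oB hB]] := countable_basis_sequence scM.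
have [rho /= rho0 rhoU] : nbhs t0 (e @^-1` U) by exact: (chart_continuous ce).
pose r i : R := rho * i.+1%:R / 22%:R.
pose C i := e @` `[t0 - r i, t0 + r i]; pose Op i := e @` `]t0 - r i, t0 + r i[.
have r_lt i j : (i < j)%N -> r i < r j.
  by move=> ij; rewrite /r ltr_pM2r ?invr_gt0 ?ltr0n // ltr_pM2l // ltr_nat.
have COp i j : (i < j)%N -> C i `<=` Op j.
  move=> /r_lt ij _ [t + <-]; rewrite /= in_itv /= => ht; exists t => //=.
  by rewrite in_itv /=; apply/andP; split; lra.
have OpC i : Op i `<=` C i.
  by move=> _ [t + <-]; rewrite /= in_itv /= => ht; exists t => //=; rewrite in_itv /=; lra.
have oOp i : open (Op i) by apply: chart_image_open ce _; exact: interval_open.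
pose BU (l : seq nat) := \bigcup_(n in [set` l]) B n.
pose A (i : nat) : set G := [set g | exists F : {ffun 'I_20 -> seq nat},
  unpickle i = Some F /\ forall j : 'I_20, psi g @` C j `<=` BU (F j) /\ BU (F j) `<=` psi g @` Op j.+1].
have covA g : exists i, A i g.
  have cov (j : 'I_20) : exists l, psi g @` C j `<=` BU l /\ BU l `<=` psi g @` Op j.+1.
    rewrite image_comp; apply: image_compact_cover => //.
    - move=> t; apply: continuous_comp; first exact: chart_continuous.
      exact: homeo_fun_continuous.
    - exact: segment_compact.
    - exact: homeo_image_open.
    - by rewrite -image_comp; apply: image_subset; exact: COp.
  have [F HF] := choice cov.
  by exists (pickle [ffun j => F j]), [ffun j => F j]; split; [exact: pickleK|move=> j; rewrite ffunE].
have AV w : quotients A w -> forall i, (i < 20)%N -> forall y, C i y -> Op i.+1 (psi w y).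
  move=> [i [u [v [[F [iF uF]] [[F' [iF' vF]] ->]]]]] j j20 y Cy.
  move: iF' vF; rewrite iF => -[<-] vF.
  have [v1 _] := vF (Ordinal j20); have [_ u2] := uF (Ordinal j20).
  have [z Oz zy] := u2 _ (v1 (psi v y) ltac:(by exists y)).
  by rewrite hom_mulE // -zy hom_KV.
have words_C n : forall g, words n (quotients A) g -> forall i, (i + n <= 20)%N ->
    forall y, C i y -> C (i + n)%N (psi g y).
  elim: n => [|n IH] g /=; first by move=> -> i _ y; rewrite addn0 hom1.
  move=> [u [v [Vu [Wv ->]]]] i i20 y Cy; rewrite hom_mulE // addnS.
  by apply/OpC/AV => //; [rewrite -addnS|apply: IH => //; rewrite (leq_trans _ i20) // addnS].
have [a Ha] := ray_words covA; exists a, (r 0%N); split.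
  by rewrite /r !divr_gt0 ?mulr_gt0 ?ltr0n.
move=> g ga t tr; have := words_C 20%N g (Ha g ga) 0%N (leqnn _) (e t).
case.
  by exists t => //=; rewrite in_itv /= -ler_distlC distrC.
move=> s + <-; rewrite /= in_itv /= -ler_distlC => sr; apply: rhoU => /=.
apply: le_lt_trans sr _; rewrite /r add0n.
by rewrite ltr_pdivrMr ?ltr0n // ltr_pM2l // ltr_nat.
Qed.

Context (hM : one_manifold R M).
Let hausM : hausdorff_space M := let: And3 h _ _ := hM in h.
Let scM : @second_countable M := let: And3 _ h _ := hM in h.

Lemma separate_points x y : x <> y ->
  exists U V : set M, [/\ nbhs x U, nbhs y V & forall z, U z -> V z -> False].
Proof.
move: hausM; rewrite open_hausdorff => H /eqP /H[[U V] /= [xU yV] [oU oV /eqP UV]].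
exists U, V; split.
- by apply: open_nbhs_nbhs; split => //; rewrite inE in xU.
- by apply: open_nbhs_nbhs; split => //; rewrite inE in yV.
- by move=> z Uz Vz; have : (U `&` V) z by []; rewrite UV.
Qed.

Lemma ray_orbit_small psi x (U : set M) : is_hom psi -> nbhs x U ->
  exists a (N : set M), nbhs x N /\ forall g, right_of a g -> forall y, N y -> U (psi g y).
Proof.
move=> hpsi xU; have [e Oe [t0 _ et0]] := atlas_cover O x; have ce := atlas_chart Oe.
rewrite -et0 in xU *; have [a [r [r0 H]]] := ray_orbit_near scM hpsi ce xU.
exists a, (e @` [set t | `|t - t0| < r]); split.
  by apply: chart_nbhs => //; exists r => // t /=; rewrite distrC.
by move=> g ga y [t /= tr <-]; apply: H => //; exact: ltW.
Qed.

(** Any g agrees with an element supported in some ray ]-oo, d[ except on a ray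
]a, +oo[ that can be taken as far as desired, so g moves x arbitrarily little. *)
Lemma fixed_by_left psi x : is_hom psi ->
  (forall b g, left_of b g -> psi g x = x) -> forall g, psi g x = x.
Proof.
move=> hpsi fx g; apply: contrapT => /separate_points[V [U [gV xU UV]]].
have [a [N [xN HN]]] := ray_orbit_small hpsi xU.
pose c := Num.max a ((g^-1)%g a).
have ac : a <= c by rewrite le_max lexx.
have agc : a <= g c by rewrite -(homeo_le_mono (g^-1)%g) homeo_KV le_max lexx orbT.
pose d := Num.max c (g c) + 1.
have cd : c < d by rewrite ltr_pwDr // le_max lexx.
have gcd : g c < d by rewrite ltr_pwDr // le_max lexx orbT.
have [q [qg qd]] := truncate_right cd gcd.
have ra : right_of a (g * q^-1)%g.
  move=> y ya; have yc : (g^-1)%g y <= c.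
    by rewrite -(homeo_le_mono g) homeo_VK; exact: le_trans agc.
  rewrite homeo_mulE -{1}(homeo_VK g y) -(qg _ yc) homeo_KV homeo_VK //.
apply: (UV (psi g x)); first exact: nbhs_singleton.
have -> : g = ((g * q^-1) * q)%g by rewrite -mulgA mulVg mulg1.
by rewrite hom_mulE // (fx d q qd); apply: HN => //; exact: nbhs_singleton.
Qed.

End continuity.

(** * Fixed points near an end *)

Section rays.
Context {R : realType}.
Local Notation G := (Homeo_plus (line_orientation R)).
Implicit Types (g h : G).

Lemma disjoint_commute g h a : left_of a g -> right_of a h -> (g * h = h * g)%g.
Proof.
move=> ga ha; apply: homeo_eq => x; rewrite !homeo_mulE.
have [xa|/ltW ax] := leP x a.
  by rewrite (ha _ xa) ha // -(ga a) // homeo_le_mono.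
by rewrite (ga _ ax) ga // -(ha a) // homeo_le_mono.
Qed.

Lemma embed_ray_right a c g : right_of c g ->
  right_of (ray_map a c) (embed (interval_map_ray a) g).
Proof.
move=> gc x xc; have [[t et]|out] := pselect (exists t, ray_map a t = x).
  rewrite -et embed_in gc // leNgt; apply/negP => /(@ray_map_lt R a).
  by rewrite et ltNge xc.
by apply: embed_out => t et; apply: out; exists t.
Qed.

Lemma embed_ray_left a c g : left_of c g ->
  left_of (ray_map a c) (embed (interval_map_ray a) g).
Proof.
move=> gc x xc.
have [t et] := @ray_map_onto R a x ltac:(by apply: lt_le_trans xc; exact: ray_map_gt).
rewrite -et embed_in gc // leNgt; apply/negP => /(@ray_map_lt R a).
by rewrite et ltNge xc.
Qed.

Lemma embed_ray_supp a g : right_of a (embed (interval_map_ray a) g).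
Proof.
by move=> x xa; apply: embed_out => t et; have := ray_map_gt a t; rewrite et ltNge xa.
Qed.

Lemma embed_ray_onto a g : right_of a g -> exists h, g = embed (interval_map_ray a) h.
Proof.
move=> ga; apply: embed_onto => x out; have [/ga//|ax] := leP x a.
by have [t et] := ray_map_onto ax; case: (out t).
Qed.

Lemma embed_segment_supp p q (pq : p < q) g :
  right_of p (embed (interval_map_segment pq) g) /\ left_of q (embed (interval_map_segment pq) g).
Proof.
by split=> x xp; apply: embed_out => t et; have := segment_map_in t pq; rewrite et; lra.
Qed.

Lemma increasing_action_embed (al : G -> R -> R) e (he : interval_map e) :
  increasing_action al -> increasing_action (al \o embed he).
Proof.
move=> [a1 aM alt]; split => /=; first by move=> x; rewrite embed1 a1.
  by move=> g h x; rewrite embedM aM.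
by move=> g; exact: alt.
Qed.

End rays.

Section local_action.
Context {R : realType} {M : topologicalType} {O : orientation R M}.
Local Notation G := (Homeo_plus (line_orientation R)).
Implicit Types (g h : G) (psi : G -> Homeo_plus O) (x y : M).
Context (hM : one_manifold R M).
Let scM : @second_countable M := let: And3 _ h _ := hM in h.

(** Inside the chart, elements of G are increasing because they preserve the
orientation. They fix both ends of the hull of the orbit of x, so the action on this
hull can be extended by the identity. The three nested arcs make all compositions
that occur stay in the chart. *)
Lemma local_increasing_action psi x (e : R -> M) (t0 r1 r2 : R) : is_hom psi ->
  atlas O e -> e t0 = x -> 0 < r1 -> 0 < r2 ->
  (forall g t, `|t - t0| <= r1 -> range e (psi g (e t))) ->
  (forall g t, `|t - t0| <= r2 -> (e @` [set s | `|s - t0| <= r1]) (psi g (e t))) ->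
  (forall g, (e @` [set s | `|s - t0| <= r2]) (psi g x)) ->
  exists al, increasing_action al /\ forall g, psi g x <> x -> al g t0 <> t0.
Proof.
move=> hpsi Oe et0 r10 r20 H1 H2 H3.
have ce := atlas_chart Oe; have einj := chart_inj ce.
have [e' eK] : exists e' : M -> R, cancel e e'.
  by have [U [e' [_ [_ _ _ eK _]]]] := ce; exists e'.
pose th g t := e' (psi g (e t)).
have eth1 g t : `|t - t0| <= r1 -> e (th g t) = psi g (e t).
  by move=> /(H1 g)[s _ es]; rewrite /th -es eK.
have eth2 g t : `|t - t0| <= r2 -> e (th g t) = psi g (e t) /\ `|th g t - t0| <= r1.
  by move=> /(H2 g)[s /= sr es]; rewrite /th -es eK.
have eth3 g : e (th g t0) = psi g x /\ `|th g t0 - t0| <= r2.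
  by have [s /= sr es] := H3 g; rewrite /th et0 -es eK.
have thM1 g h t : `|t - t0| <= r1 -> th (g * h)%g t = th g (th h t).
  by move=> tr; rewrite /th hom_mulE // -(eth1 h t tr) -/(th h t) eK.
have th_lt1 g s t : `|s - t0| <= r1 -> `|t - t0| <= r1 -> s < t -> th g s < th g t.
  rewrite !ler_distl => /andP[s1 s2] /andP[t1 t2].
  apply: (@locally_increasing R (th g) (t0 - r1) (t0 + r1)) => // u.
  rewrite -ler_distl => ur.
  have [V Vu HV] := homeo_orientation (h := psi g) Oe Oe (esym (eth1 g u ur)).
  exists V => // v w Vv Vw; rewrite -!ler_distl => vr wr.
  by apply: HV => //=; rewrite eth1.
have th1 t : th 1%g t = t by rewrite /th hom1 // eK.
pose T := [set s | exists g, s = th g t0].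
have T0 : T t0 by exists 1%g; rewrite th1.
have ubT : ubound T (t0 + r2).
  by move=> _ [g ->]; have [_] := eth3 g; rewrite ler_distl => /andP[].
have lbT : lbound T (t0 - r2).
  by move=> _ [g ->]; have [_] := eth3 g; rewrite ler_distl => /andP[].
have hsT : has_sup T by split; [exists t0|exists (t0 + r2)].
have hiT : has_inf T by split; [exists t0|exists (t0 - r2)].
pose xp := sup T; pose xm := inf T.
have t0p : t0 <= xp by apply: ub_le_sup => //; exists (t0 + r2).
have mt0 : xm <= t0 by apply: ge_inf => //; exists (t0 - r2).
have pr : xp <= t0 + r2 by apply: ge_sup => //; exists t0.
have mr : t0 - r2 <= xm by apply: lb_le_inf => //; exists t0.
have r21 : r2 <= r1.
  have [s /= sr es] := H2 1%g (t0 + r2) ltac:(by rewrite addrC addKr gtr0_norm).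
  move: es; rewrite hom1 // => /einj es; move: sr; rewrite es addrC addKr gtr0_norm //.
have xpr : `|xp - t0| <= r2 by rewrite ler_distl; lra.
have xmr : `|xm - t0| <= r2 by rewrite ler_distl; lra.
have thT g s : T s -> T (th g s).
  by move=> [h ->]; exists (g * h)%g; rewrite thM1 // subrr normr0 ltW.
have Tr s : T s -> `|s - t0| <= r1.
  by move=> [g ->]; have [_ h] := eth3 g; apply: le_trans h r21.
have th_le1 g s t : `|s - t0| <= r1 -> `|t - t0| <= r1 -> s <= t -> th g s <= th g t.
  by move=> sr tr; rewrite le_eqVlt => /orP[/eqP->//|/(th_lt1 g _ _ sr tr)/ltW].
have xp_le g : xp <= th g xp.
  apply: ge_sup; first by exists t0.
  move=> s Ts; have -> : s = th g (th (g^-1)%g s).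
    by rewrite -thM1 ?Tr // mulgV th1.
  apply: th_le1; [exact/Tr/thT|exact: le_trans r21|].
  by apply: ub_le_sup; [exists (t0 + r2)|exact: thT].
have xm_ge g : th g xm <= xm.
  apply: lb_le_inf; first by exists t0.
  move=> s Ts; have -> : s = th g (th (g^-1)%g s).
    by rewrite -thM1 ?Tr // mulgV th1.
  apply: th_le1; [exact: le_trans r21|exact/Tr/thT|].
  by apply: ge_inf; [exists (t0 - r2)|exact: thT].
have thVK g s : `|s - t0| <= r2 -> th g (th (g^-1)%g s) = s.
  by move=> sr; rewrite -thM1 ?mulgV ?th1 //; exact: le_trans r21.
have xp_fix g : th g xp = xp.
  apply/eqP; rewrite eq_le xp_le andbT -[X in _ <= X](thVK g) //.
  by apply: th_le1; [exact: le_trans r21|have [] := eth2 (g^-1)%g xp xpr|].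
have xm_fix g : th g xm = xm.
  apply/eqP; rewrite eq_le xm_ge /= -[X in X <= _](thVK g) //.
  by apply: th_le1; [have [] := eth2 (g^-1)%g xm xmr|exact: le_trans r21|].
have inX s : xm <= s <= xp -> `|s - t0| <= r1.
  by move=> /andP[h1 h2]; rewrite ler_distl; lra.
have thX g s : xm <= s <= xp -> xm <= th g s <= xp.
  move=> sX; have sr := inX s sX; have /andP[h1 h2] := sX.
  rewrite -{1}(xm_fix g) -{1}(xp_fix g).
  by rewrite !th_le1 //; apply: le_trans r21.
pose al g t := if xm <= t <= xp then th g t else t.
exists al; split; last first.
  move=> g gx; rewrite /al mt0 t0p /= => ht; apply: gx.
  by have [<- _] := eth3 g; rewrite ht.
split.
- by move=> t; rewrite /al th1 if_same.
- move=> g h t; rewrite /al; case: ifP => tX; last by rewrite tX.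
  by rewrite thX // thM1 // inX.
- move=> g s t st; rewrite /al; case: ifP => sX; case: ifP => tX //.
  + by apply: th_lt1 => //; exact: inX.
  + have /andP[_ h] := thX g s sX; have /andP[h1 h2] := sX.
    by apply: le_lt_trans h _; rewrite ltNge; apply/negP => h3; move: tX; rewrite h3 andbT; lra.
  + have /andP[h _] := thX g t tX; have /andP[h1 h2] := tX.
    by apply: lt_le_trans h; rewrite ltNge; apply/negP => h3; move: sX; rewrite h3 /=; lra.
Qed.

(** The group of elements supported in ]c, +oo[ moves x, hence so do its elements of
bounded support, by fixed_by_left. *)
Lemma bounded_moving psi x c : is_hom psi ->
  (forall a, exists g, right_of a g /\ psi g x <> x) ->
  exists g d, [/\ right_of c g, left_of d g & psi g x <> x].
Proof.
move=> hpsi H; apply: contrapT => no.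
have [g [gc gx]] := H c; have [h gh] := embed_ray_onto gc; apply: gx; rewrite gh.
apply: (fixed_by_left hM (hom_embed (interval_map_ray c) hpsi)) => b k kb.
apply: contrapT => kx; apply: no; exists (embed (interval_map_ray c) k), (ray_map c b).
by split => //; [exact: embed_ray_supp|exact: embed_ray_left].
Qed.

(** Elements supported in a far ray keep x in a chart and act on the line there. If they
moved x in all rays, then x would be moved by elements supported in two
disjoint segments, that is, by two commuting actions of G. *)
Lemma ray_fixes psi x : is_hom psi -> exists a, forall g, right_of a g -> psi g x = x.
Proof.
move=> hpsi; apply: contrapT => no.
have act a : exists g, right_of a g /\ psi g x <> x.
  apply: contrapT => H; apply: no; exists a => g ga; apply: contrapT => gx.
  by apply: H; exists g.
have [e Oe [t0 _ et0]] := atlas_cover O x; have ce := atlas_chart Oe.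
have nb (r : R) : 0 < r -> nbhs (e t0) (e @` [set s | `|s - t0| <= r]).
  by move=> r0; apply: chart_nbhs => //; exists r => // t /=; rewrite distrC => /ltW.
have nb0 : nbhs (e t0) (range e) by apply: chart_nbhs => //; exact: filterT.
have [a1 [r1 [r10 H1]]] := ray_orbit_near scM hpsi ce nb0.
have [a2 [r2 [r20 H2]]] := ray_orbit_near scM hpsi ce (nb r1 r10).
have [a3 [r3 [r30 H3]]] := ray_orbit_near scM hpsi ce (nb r2 r20).
pose a := Num.max a1 (Num.max a2 a3).
have a1a : a1 <= a by rewrite le_max lexx.
have a2a : a2 <= a by rewrite !le_max lexx orbT.
have a3a : a3 <= a by rewrite !le_max lexx !orbT.
pose psi' := psi \o embed (interval_map_ray a).
have hpsi' : is_hom psi' := hom_embed _ hpsi.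
have sa g := @embed_ray_supp R a g.
have [al [Al alx]] : exists al, increasing_action al /\
    forall g, psi' g x <> x -> al g t0 <> t0.
  apply: (@local_increasing_action psi' x e t0 r1 r2) => //.
  - by move=> g t tr; apply: H1 => //; exact: right_of_le (sa g).
  - by move=> g t tr; apply: H2 => //; exact: right_of_le (sa g).
  - move=> g; rewrite -et0; apply: H3; last by rewrite subrr normr0 ltW.
    exact: right_of_le (sa g).
have act' c : exists g, right_of c g /\ psi' g x <> x.
  have [g [gc gx]] := act (ray_map a c).
  have [h gh] : exists h, g = embed (interval_map_ray a) h.
    by apply: embed_ray_onto; apply: right_of_le gc; exact/ltW/ray_map_gt.
  exists h; split; last by rewrite /psi' /= -gh.
  move=> t tc; apply: (interval_map_inj (interval_map_ray a)).
  rewrite -(embed_in (interval_map_ray a)) -gh; apply: gc.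
  by move: tc; rewrite le_eqVlt => /orP[/eqP->//|/(@ray_map_lt R a)/ltW].
have [g1 [d1 [g1r g1l g1x]]] := bounded_moving 0 hpsi' act'.
pose D1 := Num.max d1 0 + 1.
have d1D : d1 < D1 by rewrite ltr_pwDr // le_max lexx.
have D10 : 0 < D1 by rewrite ltr_pwDr // le_max lexx orbT.
have [g2 [d2 [g2r g2l g2x]]] := bounded_moving (D1 + 1) hpsi' act'.
pose D2 := Num.max d2 (D1 + 1) + 1.
have d2D : d2 < D2 by rewrite ltr_pwDr // le_max lexx.
have D12 : D1 + 1 < D2 by rewrite ltr_pwDr // le_max lexx orbT.
have pq1 : -1 < D1 by lra.
have pq2 : D1 < D2 by lra.
have [h1 [_ [_ [gh1 _ _ _]]]] := @segment_pullback R g1 (-1) 0 (D1 - 1 / 2) D1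
  ltac:(by lra) ltac:(by rewrite /D1; have := le_max 0 d1 0; rewrite lexx orbT => ?; lra)
  ltac:(by lra) pq1 g1r ltac:(by apply: left_of_le g1l; rewrite /D1; have := le_max d1 d1 0; rewrite lexx => ?; lra).
have [h2 [a' [b' [gh2 ab' h2a h2b]]]] := @segment_pullback R g2 D1 (D1 + 1) (D2 - 1 / 2) D2
  ltac:(by lra) ltac:(by rewrite /D2; have := le_max (D1 + 1) d2 (D1 + 1); rewrite lexx orbT => ?; lra)
  ltac:(by lra) pq2 g2r ltac:(by apply: left_of_le g2l; rewrite /D2; have := le_max d2 d2 (D1 + 1); rewrite lexx => ?; lra).
have Al1 := increasing_action_embed (interval_map_segment pq1) Al.
have Al2 := increasing_action_embed (interval_map_segment pq2) Al.
apply: (alx _ g2x); rewrite gh2.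
apply: (commuting_actions_trivial Al1 Al2 _ _ ab' h2a h2b (g := h1)).
  move=> g h t /=; have [_ aM _] := Al; rewrite -!aM; congr (al _ t).
  apply: (@disjoint_commute R _ _ D1); first by have [] := embed_segment_supp pq1 g.
  by have [] := embed_segment_supp pq2 h.
by rewrite /= -gh1; exact: alx.
Qed.

End local_action.

(** * Orbits with the stabilizers of points *)

Section orbit.
Context {R : realType} {M : topologicalType} {O : orientation R M}.
Local Notation G := (Homeo_plus (line_orientation R)).
Implicit Types (g h : G) (x y : M).
Context (hM : one_manifold R M).
Let scM : @second_countable M := let: And3 _ h _ := hM in h.
Context (psi : G -> Homeo_plus O) (hpsi : is_hom psi) (x : M) (t0 : R).
Context (stab : forall g, psi g x = x <-> g t0 = t0).

(** The equivariant map from the line to M sending t0 to x. *)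
Definition orbit_map (s : R) : M := psi (translation (s - t0)) x.
Local Notation f := orbit_map.

Lemma orbit_map_base : f t0 = x.
Proof. by rewrite /f subrr translation0 hom1. Qed.

Lemma orbit_mapE g s : psi g (f s) = f (g s).
Proof.
rewrite /f -hom_mulE //.
set k := translation (g s - t0).
have -> : (g * translation (s - t0) = k * (k^-1 * (g * translation (s - t0))))%g.
  by rewrite mulgA mulgV mul1g.
rewrite hom_mulE //; congr (homeo_fun (psi k) _); apply/stab.
have kT u : translation (u - t0) t0 = u by rewrite translationE addrC subrK.
by rewrite !homeo_mulE kT -{1}(kT (g s)) homeo_KV.
Qed.

Lemma orbit_map_inj : injective f.
Proof.
move=> s s'; rewrite /f => e.
have : psi ((translation (s - t0))^-1 * translation (s' - t0))%g x = x.
  by rewrite hom_mulE // -e (hom_KV _ _ hpsi).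
move/stab; rewrite homeo_mulE -translationN !translationE; lra.
Qed.

Lemma orbit_map_onto g : psi g x = f (g t0).
Proof. by rewrite -orbit_mapE orbit_map_base. Qed.

(** Among uncountably many s there are two, s1 < s2, for which the same basic open set
contains the value and is contained in the translate of V. Translating each value
by the other parameter gives a point on either side of t0. *)
Lemma orbit_map_cluster (U : set M) (eps : R) : nbhs x U -> 0 < eps ->
  (exists s, t0 < s < t0 + eps /\ U (f s)) /\ (exists s, t0 - eps < s < t0 /\ U (f s)).
Proof.
move=> xU e0; have [B [oB hB]] := countable_basis_sequence scM.
have [V [oV Vx] VU] : exists2 V, open_nbhs x V & V `<=` U.
  by move: xU; rewrite nbhsE => -[V ? ?]; exists V.
have [i [s1 [s2 [h1 h12 h2 [B1 V1] [B2 V2]]]]] := @interval_pigeonhole R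
  (fun i s => B i (f s) /\ B i `<=` psi (translation (s - t0)) @` V) t0 (t0 + eps)
  ltac:(by lra) (fun s _ => hB (f s) (psi (translation (s - t0)) @` V)
     (open_nbhs_nbhs (conj (homeo_image_open _ oV) (ex_intro2 _ _ x Vx erefl)))).
have shift s s' : B i (f s') -> B i `<=` psi (translation (s - t0)) @` V ->
    U (f (s' - s + t0)).
  move=> Bs' /(_ _ Bs')[z Vz zs']; apply: VU.
  suff -> : f (s' - s + t0) = z by [].
  rewrite -(hom_KV (translation (s - t0)) z hpsi) zs' -translationN orbit_mapE.
  by congr f; rewrite translationE; ring.
split; [exists (s2 - s1 + t0)|exists (s1 - s2 + t0)]; split; try exact: shift.
- by lra.
- by lra.
Qed.

(** Elements supported near the end of the interval keep points of N in U and act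
transitively there, so one value in N forces all values near the end into U. *)
Lemma orbit_map_end e (he : interval_map e) (U : set M) :
  (forall (N : set M) a, nbhs x N -> exists v, a < v /\ N (f (e v))) ->
  nbhs x U -> exists a : R, forall v, a < v -> U (f (e v)).
Proof.
move=> cl xU.
have [a [N [xN HN]]] := ray_orbit_small hM (hom_embed he hpsi) xU.
exists a => v av; have [w [aw Nw]] := cl N a xN.
have hw : w <= Num.max v w by rewrite le_max lexx orbT.
have hv : v <= Num.max v w by rewrite le_max lexx.
have [g [ga _ gw]] := @homeo_move R a (Num.max v w + 1) w v
  ltac:(by lra) ltac:(by lra).
by have := HN g ga _ Nw; rewrite /= orbit_mapE embed_in gw.
Qed.

Lemma orbit_map_near (U : set M) : nbhs x U ->
  exists2 eps : R, 0 < eps & forall s, `|s - t0| < eps -> U (f s).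
Proof.
move=> xU.
have pq : t0 < t0 + 1 by rewrite ltrDl.
have pq' : t0 - 1 < t0 by rewrite ltrBlDr ltrDl.
have [ap Hp] : exists2 ep : R, 0 < ep & forall s, t0 < s -> s < t0 + ep -> U (f s).
  have he := interval_map_comp (interval_map_segment pq) (@interval_map_opp R).
  have [N a xN|a Ha] := orbit_map_end he _ xU.
    have /andP[h1 h2] := segment_map_in (- a) pq.
    have [[s [/andP[s1 s2] Ns]] _] := @orbit_map_cluster N (segment_map t0 (t0 + 1) (- a) - t0)
      xN ltac:(by lra).
    have [v ev] := @segment_map_onto R t0 (t0 + 1) s ltac:(by lra).
    exists (- v); rewrite /= opprK ev; split => //.
    rewrite ltrNr -(leW_mono (le_mono (fun u w => @segment_map_lt R _ _ u w pq))) ev; lra.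
  have /andP[h1 h2] := segment_map_in (- a) pq.
  exists (segment_map t0 (t0 + 1) (- a) - t0); first by lra.
  move=> s s1 s2; have [v ev] := @segment_map_onto R t0 (t0 + 1) s ltac:(by lra).
  have := Ha (- v); rewrite /= opprK ev; apply.
  rewrite ltrNr -(leW_mono (le_mono (fun u w => @segment_map_lt R _ _ u w pq))) ev; lra.
have [am Hm] : exists2 em : R, 0 < em & forall s, t0 - em < s -> s < t0 -> U (f s).
  have he := interval_map_segment pq'.
  have [N a xN|a Ha] := orbit_map_end he _ xU.
    have /andP[h1 h2] := segment_map_in a pq'.
    have [_ [s [/andP[s1 s2] Ns]]] := @orbit_map_cluster N (t0 - segment_map (t0 - 1) t0 a)
      xN ltac:(by lra).
    have [v ev] := @segment_map_onto R (t0 - 1) t0 s ltac:(by lra).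
    exists v; rewrite ev; split => //.
    rewrite -(leW_mono (le_mono (fun u w => @segment_map_lt R _ _ u w pq'))) ev; lra.
  have /andP[h1 h2] := segment_map_in a pq'.
  exists (t0 - segment_map (t0 - 1) t0 a); first by lra.
  move=> s s1 s2; have [v ev] := @segment_map_onto R (t0 - 1) t0 s ltac:(by lra).
  have := Ha v; rewrite ev; apply.
  rewrite -(leW_mono (le_mono (fun u w => @segment_map_lt R _ _ u w pq'))) ev; lra.
move=> fm fp; exists (Num.min ap am); first by rewrite lt_min; apply/andP.
move=> s; rewrite lt_min !ltr_distl => /andP[/andP[_ h1] /andP[h2 _]].
have [h|h|->] := ltgtP s t0; [exact: fm|exact: fp|].
by rewrite orbit_map_base; exact: nbhs_singleton.
Qed.

Lemma orbit_map_continuous : continuous f.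
Proof.
move=> s; pose k := translation (s - t0).
have ks : psi k x = f s by [].
move=> U /= fsU.
have xU : nbhs x (psi k @^-1` U) by apply: (@homeo_fun_continuous _ _ _ (psi k)); rewrite ks.
have [eps e0 H] := orbit_map_near xU.
exists eps => // s' /=; rewrite distrC => ss'.
have -> : s' = k (s' - (s - t0)) by rewrite translationE subrK.
rewrite -orbit_mapE; apply: H; rewrite (_ : _ - t0 = s' - s) //; by ring.
Qed.

(** In a chart, the orbit map is a continuous injection of a segment into the line, so
it is monotone, and the intermediate value theorem applies. *)
Lemma orbit_map_nbhs (V : set R) : nbhs t0 V -> nbhs x (f @` V).
Proof.
move=> [eps /= e0 epsV].
have [e Oe [t1 _ et1]] := atlas_cover O x; have ce := atlas_chart Oe.
have [U [e' [oU [_ ce' Ue eK e'K]]]] := ce.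
have xU : nbhs x U by apply: open_nbhs_nbhs; split => //; rewrite -et1.
have [d0 d00 Hd] := orbit_map_near xU.
pose d := Num.min eps d0 / 2.
have dm1 : Num.min eps d0 <= eps by rewrite ge_min lexx.
have dm2 : Num.min eps d0 <= d0 by rewrite ge_min lexx orbT.
have dm0 : 0 < Num.min eps d0 by rewrite lt_min e0.
have dd0 : 0 < d by rewrite /d; lra.
have fU s : s \in `[t0 - d, t0 + d] -> U (f s).
  by rewrite in_itv /= => hs; apply: Hd; rewrite ltr_distl; rewrite /d in hs; lra.
pose F := e' \o f.
have eF s : s \in `[t0 - d, t0 + d] -> e (F s) = f s by move=> /fU Us; rewrite /F /= e'K.
have Finj : {in `[t0 - d, t0 + d] &, injective F}.
  by move=> s s' hs hs' FF; apply: orbit_map_inj; rewrite -!eF // FF.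
have cF : {within `[t0 - d, t0 + d], continuous F}.
  rewrite continuous_subspace_in => s; rewrite inE => hs.
  apply: continuous_subspaceT_for => //.
  apply: continuous_comp; first exact: orbit_map_continuous.
  move: ce'; rewrite continuous_open_subspace// => h; exact: (h (f s) (mem_set (fU s hs))).
have Ft0 : F t0 = t1 by rewrite /F /= orbit_map_base -et1 eK.
have mem s : t0 - d <= s <= t0 + d -> s \in `[t0 - d, t0 + d] by rewrite in_itv.
have m1 := mem (t0 - d) ltac:(by lra); have m2 := mem (t0 + d) ltac:(by lra).
have m0 := mem t0 ltac:(by lra).
have key : nbhs t1 [set r | Num.min (F (t0 - d)) (F (t0 + d)) <= r <=
    Num.max (F (t0 - d)) (F (t0 + d))].
  have h1 : t0 - d < t0 by lra. have h2 : t0 < t0 + d by lra.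
  have [Fm|Fm] := itv_continuous_inj_mono cF Finj.
    have l1 : F (t0 - d) < t1 by rewrite -Ft0; apply: Fm.
    have l2 : t1 < F (t0 + d) by rewrite -Ft0; apply: Fm.
    near=> r; rewrite /= ge_min le_max.
    have -> : F (t0 - d) <= r by apply: ltW; near: r; exact: lt_nbhsr.
    by have -> : r <= F (t0 + d) by [apply: ltW; near: r; exact: lt_nbhsl]; rewrite orbT.
  have l1 : t1 < F (t0 - d) by rewrite -Ft0; apply: Fm.
  have l2 : F (t0 + d) < t1 by rewrite -Ft0; apply: Fm.
  near=> r; rewrite /= ge_min le_max.
  have -> : F (t0 + d) <= r by apply: ltW; near: r; exact: lt_nbhsr.
  by have -> : r <= F (t0 - d) by [apply: ltW; near: r; exact: lt_nbhsl]; rewrite orbT.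
have := chart_nbhs ce key; rewrite et1; apply: filterS => y [r /= hr <-].
have ab : t0 - d <= t0 + d by lra.
have [s hs Fs] := IVT ab cF hr.
exists s; last by rewrite -eF // Fs.
by apply: epsV => /=; move: hs; rewrite in_itv /= distrC ltr_distl /d => hs; lra.
Unshelve. all: by end_near. Qed.

Lemma orbit_map_nbhs_at s (V : set R) : nbhs s V -> nbhs (f s) (f @` V).
Proof.
pose k := translation (s - t0).
move=> sV; have t0V : nbhs t0 (k @^-1` V).
  by apply: (@homeo_fun_continuous _ _ _ (k)); rewrite /k translationE addrC subrK.
have := orbit_map_nbhs t0V => xV.
have : nbhs (f s) (psi (k^-1)%g @^-1` (f @` (k @^-1` V))).
  apply: (@homeo_fun_continuous _ _ _ (psi (k^-1)%g)).
  by have -> : psi (k^-1)%g (f s) = x by rewrite -(hom_KV k x hpsi).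
apply: filterS => y [r /= Vr fr]; exists (k r) => //.
by rewrite -orbit_mapE fr hom_VK.
Qed.

Lemma orbit_map_homeomorphism : open (range f) /\
  exists f' : M -> R, homeomorphism_onto (range f) f f'.
Proof.
have oI : open (range f).
  rewrite openE => _ [s _ <-]; exact: (orbit_map_nbhs_at (filterT : nbhs s setT)).
split => //.
have [f' fK] : {f' : M -> R & cancel f f'}.
  have H y : exists s, (exists u, f u = y) -> f s = y.
    by have [[u fu]|nu] := pselect (exists u, f u = y); [exists u|exists 0].
  have [f' Hf'] := choice H; exists f' => s.
  by apply: orbit_map_inj; apply: Hf'; exists s.
exists f'; split; [exact: orbit_map_continuous| |by move=> s; exists s|exact: fK|].
- rewrite continuous_open_subspace // => y; rewrite inE => -[s _ <-] V /=.
  rewrite fK => /orbit_map_nbhs_at; apply: filterS => _ [r Vr <-] /=.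
  by rewrite fK.
- by move=> y [s _ <-]; rewrite fK.
Qed.

End orbit.

(** * Stabilizers of points of the manifold *)

Section stabilizers.
Context {R : realType} {M : topologicalType} {O : orientation R M}.
Local Notation G := (Homeo_plus (line_orientation R)).
Implicit Types (g h : G) (psi : G -> Homeo_plus O) (x y : M).
Context (hM : one_manifold R M).

Lemma reflect_right b g : right_of b g -> left_of (- b) (embed (@interval_map_opp R) g).
Proof. by move=> gb x xb; rewrite -[x]opprK embed_in gb // lerNl. Qed.

Lemma hom_reflectK psi g :
  psi g = psi (embed (@interval_map_opp R) (embed (@interval_map_opp R) g)).
Proof. by rewrite reflectK. Qed.

Lemma fixed_by_right psi x : is_hom psi ->
  (forall a g, right_of a g -> psi g x = x) -> forall g, psi g x = x.
Proof.
move=> hpsi fx g; rewrite hom_reflectK.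
apply: (fixed_by_left hM (hom_embed (@interval_map_opp R) hpsi)) => b h /reflect_left.
exact: fx.
Qed.

(** The infimum is attained, by fixed_by_right inside the ray that starts at it. *)
Lemma right_end psi x : is_hom psi -> (exists g, psi g x <> x) -> exists r,
  (forall g, right_of r g -> psi g x = x) /\
  (forall a, a < r -> exists g, right_of a g /\ psi g x <> x).
Proof.
move=> hpsi [g0 g0x]; pose T := [set a | forall g, right_of a g -> psi g x = x].
have T0 : T !=set0 by have [a Ha] := ray_fixes hM x hpsi; exists a.
have iT : has_inf T.
  split => //; apply: contrapT => no; apply: g0x; apply: fixed_by_right => // a g ga.
  apply: contrapT => gx; apply: no; exists a => b Tb; rewrite leNgt; apply/negP => ba.
  by apply: gx; apply: Tb; apply: right_of_le ga; exact: ltW.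
exists (inf T); split.
  move=> g /embed_ray_onto[h ->].
  apply: (fixed_by_right (hom_embed (interval_map_ray _) hpsi)) => a k /embed_ray_right ka.
  have [b Tb ba] := @inf_adherent _ T (ray_map (inf T) a - inf T)
    ltac:(by rewrite subr_gt0; exact: ray_map_gt) iT.
  apply: Tb; apply: right_of_le (ka (inf T)); apply: ltW.
  by move: ba; rewrite addrC subrK.
move=> a ai; apply: contrapT => no.
have : inf T <= a.
  apply: ge_inf; first by case: iT.
  by move=> g ga; apply: contrapT => gx; apply: no; exists g.
by rewrite leNgt ai.
Qed.

Lemma left_end psi x : is_hom psi -> (exists g, psi g x <> x) -> exists l,
  (forall g, left_of l g -> psi g x = x) /\
  (forall b, l < b -> exists g, left_of b g /\ psi g x <> x).
Proof.
move=> hpsi [g gx]; have [|r [H1 H2]] := @right_end _ x (hom_embed (@interval_map_opp R) hpsi).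
  by exists (embed (@interval_map_opp R) g); rewrite /= reflectK.
exists (- r); split.
  by move=> h /reflect_left; rewrite opprK => /H1 /=; rewrite reflectK.
move=> b; rewrite ltrNl => /H2[h [/reflect_right hb hx]].
by exists (embed (@interval_map_opp R) h); rewrite opprK in hb.
Qed.

Lemma near_left psi x p q : is_hom psi -> p < q -> exists c, p < c < q /\
  forall g, right_of c g -> left_of q g -> psi g x = x.
Proof.
move=> hpsi pq; have [a Ha] := ray_fixes hM x (hom_embed (interval_map_segment pq) hpsi).
exists (segment_map p q a); split; first exact: segment_map_in.
move=> g gc gq; have /andP[h1 h2] := segment_map_in a pq.
have [h gh] : exists h, g = embed (interval_map_segment pq) h.
  apply: embed_onto => y out; have [yp|py] := leP y p; first by apply: gc; lra.
  have [/gq//|yq] := leP q y.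
  by have [t et] := @segment_map_onto R p q y ltac:(by lra); case: (out t).
rewrite gh; apply: Ha => t ta; apply: (interval_map_inj (interval_map_segment pq)).
rewrite -(embed_in (interval_map_segment pq)) -gh; apply: gc.
by rewrite (le_mono (fun u w => @segment_map_lt R _ _ u w pq)).
Qed.

(** In the group of elements supported in ]p, r + 1[, those fixing r split at r and thus
fix x. If any other one fixed x, all would by maximality, and then so would the
elements supported in ]p, +oo[, which are generated by those supported in
]r, +oo[ and in ]p, r + 1[; this contradicts the choice of r. *)
Lemma right_end_stabilizer psi x r p t (pr : p < r) (pq : p < r + 1) : is_hom psi ->
  (forall g, right_of r g -> psi g x = x) ->
  (forall a, a < r -> exists g, right_of a g /\ psi g x <> x) ->
  (forall g, right_of p g -> left_of r g -> psi g x = x) ->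
  segment_map p (r + 1) t = r ->
  forall g, psi (embed (interval_map_segment pq) g) x = x <-> g t = t.
Proof.
move=> hpsi fixr mover fixl et.
have hpsi' := hom_embed (interval_map_segment pq) hpsi.
have mono := le_mono (fun u w => @segment_map_lt R _ _ u w pq).
have fixt g : g t = t -> psi (embed (interval_map_segment pq) g) x = x.
  move=> /fix_factor[h [k [ht kt ->]]]; rewrite embedM hom_mulE //.
  have [hp hq] := embed_segment_supp pq h; have [kp kq] := embed_segment_supp pq k.
  rewrite [X in psi _ X]fixr; last first.
    move=> y yr; have [[u eu]|out] := pselect (exists u, segment_map p (r + 1) u = y).
      by rewrite -eu embed_in kt // -mono eu et.
    by apply: embed_out => u eu; apply: out; exists u.
  apply: fixl => // y ry; have [[u eu]|out] := pselect (exists u, segment_map p (r + 1) u = y).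
    by rewrite -eu embed_in ht // -mono eu et.
  by apply: embed_out => u eu; apply: out; exists u.
move=> g; split; last exact: fixt.
move=> gx; apply: contrapT => gt.
have all := @stabilizer_maximal R _ t (stabilizer_subgroup x hpsi') fixt
  (ex_intro _ g (conj gx gt)).
have [k [kp kx]] := mover p pr; apply: kx.
have [k' ->] := embed_ray_onto kp.
have hpsi'' := hom_embed (interval_map_ray p) hpsi.
have [a ea] := ray_map_onto pr.
have [b eb] := @ray_map_onto R p (r + 1) pq.
have ab : a < b.
  by rewrite -(leW_mono (le_mono (@ray_map_lt R p))) ea eb ltrDl.
apply: (overlapping_rays (stabilizer_subgroup x hpsi'') ab).
  by move=> h /embed_ray_right /= /(_ p); rewrite ea => /fixr.
move=> h /embed_ray_left /= /(_ p); rewrite eb => hq.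
have hp := @embed_ray_supp R p h.
have [h' ->] : exists h', embed (interval_map_ray p) h = embed (interval_map_segment pq) h'.
  apply: embed_onto => y out; have [/hp//|py] := leP y p; have [/hq//|yq] := leP (r + 1) y.
  by have [u eu] := @segment_map_onto R p (r + 1) y ltac:(by rewrite py); case: (out u).
exact: all.
Qed.

(** Both orbits contain a neighborhood of x, so the second one contains a point y of the
first one other than x. Elements of the first group fixing t1 fix x, and also y
because they commute with the second group; so does the stabilizer of another point
of the line, and by maximality the whole first group fixes y. *)
Lemma commuting_stabilizers (psi1 psi2 : G -> Homeo_plus O) x t1 t2 :
  is_hom psi1 -> is_hom psi2 ->
  (forall g h y, psi1 g (psi2 h y) = psi2 h (psi1 g y)) ->
  (forall g, psi1 g x = x <-> g t1 = t1) -> (forall g, psi2 g x = x <-> g t2 = t2) -> False.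
Proof.
move=> h1 h2 comm st1 st2.
have xr : nbhs x (range (orbit_map psi2 x t2)).
  by apply: (orbit_map_nbhs hM h2 st2); exact: filterT.
have [eps e0 H] := orbit_map_near hM h1 st1 xr.
pose s := t1 + eps / 2.
have [s' _ s'E] := H s ltac:(by rewrite /s addrC addKr gtr0_norm; lra).
set y := orbit_map psi1 x t1 s in s'E.
have fix1 g : g t1 = t1 -> psi1 g y = y.
  by move=> /st1 gx; rewrite -s'E /orbit_map comm gx.
have fix2 g : g s = s -> psi1 g y = y.
  by move=> gs; rewrite /y orbit_mapE // gs.
have [g [gs gt]] : exists g : G, g s = s /\ g t1 <> t1.
  have [g [h3 h4]] := @homeo_affine R t1 s (t1 - 1) s ltac:(by rewrite /s; lra) ltac:(by rewrite /s; lra).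
  by exists g; split => //; rewrite h3; lra.
have all := stabilizer_maximal (stabilizer_subgroup y h1) fix1
  (ex_intro _ g (conj (fix2 _ gs) gt)).
have := all (translation 1); rewrite /= /y orbit_mapE //.
by move=> /(orbit_map_inj h1 st1); rewrite translationE; lra.
Qed.

(** The case l < r is excluded by restricting psi to disjoint neighborhoods of l and
of r; ray_fixes, used between l and r, makes these neighborhoods available. The
left end is treated as a right end by reflecting the line. *)
Lemma point_stabilizer psi x : is_hom psi -> (exists g, psi g x <> x) ->
  exists t, forall g, psi g x = x <-> g t = t.
Proof.
move=> hpsi nx; have [r [r1 r2]] := right_end hpsi nx; have [l [l1 l2]] := left_end hpsi nx.
have gS := stabilizer_subgroup x hpsi.
have nall : ~ (forall g, psi g x = x) by move=> H; have [g] := nx; exact.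
have [lr|rl|lr] := ltgtP l r; last 2 first.
- by exfalso; apply: nall; exact: overlapping_rays gS rl r1 l1.
- have fixr g : g r = r -> psi g x = x.
    by move=> /fix_factor[h [k [hr kr ->]]]; rewrite hom_mulE // r1 // l1 // lr.
  exists r => g; split; last exact: fixr.
  move=> gx; apply: contrapT => gr; apply: nall.
  exact: (stabilizer_maximal gS fixr (ex_intro _ g (conj gx gr))).
exfalso; pose m := (l + r) / 2.
have mr : m < r by rewrite /m; lra.
have lm : - m < - l by rewrite /m; lra.
have [c2 [/andP[mc2 c2r] fix2]] := near_left x hpsi mr.
have hpsiN := hom_embed (@interval_map_opp R) hpsi.
have [c1 [/andP[mc1 c1l] fix1]] := near_left x hpsiN lm.
have pq2 : c2 < r + 1 by lra.
have pq1 : c1 < - l + 1 by lra.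
have [t2 et2] := @segment_map_onto R c2 (r + 1) r ltac:(by lra).
have [t1 et1] := @segment_map_onto R c1 (- l + 1) (- l) ltac:(by lra).
have st2 := right_end_stabilizer c2r pq2 hpsi r1 r2 fix2 et2.
have l1N g : right_of (- l) g -> (psi \o embed (@interval_map_opp R)) g x = x.
  by move=> /reflect_right; rewrite opprK; exact: l1.
have l2N a : a < - l -> exists g, right_of a g /\ (psi \o embed (@interval_map_opp R)) g x <> x.
  rewrite ltrNr => /l2[g [/reflect_left ga gx]].
  by exists (embed (@interval_map_opp R) g); rewrite opprK in ga; rewrite /= reflectK.
have st1 := right_end_stabilizer c1l pq1 hpsiN l1N l2N fix1 et1.
apply: (commuting_stabilizers (hom_embed _ hpsiN) (hom_embed _ hpsi) _ st1 st2) => g h y /=.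
rewrite -!hom_mulE //; congr (homeo_fun (psi _) y).
apply: (@disjoint_commute R _ _ m).
  have [gc _] := embed_segment_supp pq1 g.
  by rewrite -[m]opprK; apply: reflect_right; apply: right_of_le gc; exact: ltW.
have [hc _] := embed_segment_supp pq2 h.
by apply: right_of_le hc; exact: ltW.
Qed.

Lemma hom_topologically_diagonal (psi : G -> Homeo_plus O) : is_hom psi ->
  topologically_diagonal_embedding psi.
Proof.
move=> hpsi.
pose orb x := [set y | exists g, y = psi g x].
pose J := {A : set M | exists x, (exists g, psi g x <> x) /\ A = orb x}.
have F (n : J) : {xf : (R -> M) * (M -> R) | [/\ open (sval n),
    homeomorphism_onto (sval n) xf.1 xf.2 & forall g s, psi g (xf.1 s) = xf.1 (g s)]}.
  apply: cid; have [x [nx An]] := svalP n.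
  have [t st] := point_stabilizer hpsi nx.
  have [oI [f' hf']] := orbit_map_homeomorphism hM hpsi st.
  have rE : range (orbit_map psi x t) = sval n.
    rewrite An; apply/seteqP; split => y /=; first by move=> [s _ <-]; exists (translation (s - t)).
    by move=> [g ->]; rewrite (orbit_map_onto hpsi st); exists (g t).
  exists (orbit_map psi x t, f'); rewrite -rE; split => //= g s.
  exact: orbit_mapE.
exists J, (fun n => sval n), (fun n => (sval (F n)).1), (fun n => (sval (F n)).2); split.
- by move=> n; have [] := svalP (F n).
- move=> [A pA] [B pB] _ _ [y [/= Ay By]].
  have AB : A = B.
    have [x [_ Ax]] := pA; have [x' [_ Bx]] := pB.
    move: Ay By; rewrite Ax Bx => -[g yg] [g' yg'].
    apply/seteqP; split => z [k ->].
      exists (k * (g^-1 * g'))%g.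
      by rewrite !hom_mulE // -yg' yg hom_KV.
    exists (k * (g'^-1 * g))%g.
    by rewrite !hom_mulE // -yg yg' hom_KV.
  by subst B; congr exist; exact: Prop_irrelevance.
- by move=> n; have [] := svalP (F n).
move=> g y; split.
  move=> n ny; have [_ [_ _ _ _ fK] fE] := svalP (F n).
  by rewrite -fE fK.
move=> out; apply: contrapT => gy.
have Jy : exists x, (exists g, psi g x <> x) /\ orb y = orb x.
  by exists y; split => //; exists g.
by apply: (out (exist _ (orb y) Jy)); exists 1%g; rewrite hom1.
Qed.

End stabilizers.

Theorem theorem4p4 (R : realType) (M : topologicalType) (O : orientation R M)
    (hM : one_manifold R M)
    (phi : {multiplicative Homeo_plus (line_orientation R) -> Homeo_plus O})
    (hphi : exists g : Homeo_plus (line_orientation R), phi g <> 1%g) :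
  topologically_diagonal_embedding phi.
Proof.
by apply: (hom_topologically_diagonal hM); exact: gmulfM.
Qed.
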